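(* Let $W_{n,i}$ be the degree of vertex $i$ in the graph $G_n$ of Model 1 or Model 2 (described in the context) and let $b_{n,i}^2=\mathbb{E}W_{n,i}^2$ (with $b_{n,i}>0$). For Model 1 with $2\le i\le n$ there are constants $c,C>0$ independent of $n$ such that $$\frac{c}{\sqrt n}\le d_{\mathrm K}\bigl(\mathscr{L}(W_{n,i}/b_{n,i}),K_{i-1}\bigr)\le \frac{C}{\sqrt n}.$$ For Model 2 with $1\le i\le n$ there are constants $c,C>0$ independent of $n$ such that $$\frac{c}{\sqrt n}\le d_{\mathrm K}\bigl(\mathscr{L}(W_{n,i}/b_{n,i}),K_{i-1/2}\bigr)\le \frac{C}{\sqrt n}.$$
   Context: Model 1: start with a graph $G_2$ with two vertices labeled $1$ and $2$ and one edge directed from vertex $2$ to vertex $1$. Given $G_n$, the graph $G_{n+1}$ is obtained by adding a vertex labeled $n+1$ and a single directed edge from it to a random vertex in $\{1,\dots,n\}$, where the conditional probability that $n+1$ connects to vertex $i$ is proportional to the degree of $i$ in $G_n$. Model 2: start with a graph $G_1$ with a single vertex labeled $1$ and an edge directed from vertex $1$ to itself. Given $G_n$, the graph $G_{n+1}$ is obtained by adding a vertex labeled $n+1$ and a single directed edge from it to a random vertex in $\{1,\dots,n+1\}$, where the conditional probability that $n+1$ connects to $i\in\{1,\dots,n\}$ is proportional to the degree of $i$ in $G_n$, and the conditional probability that $n+1$ connects to itself is $1/(2n+1)$. Degree means in-degree plus out-degree; a loop at a vertex contributes $2$ to its degree. For $s\ge 1/2$, $K_s$ denotes the probability distribution (and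 its distribution function) on $(0,\infty)$ with density $$\kappa_s(x)=\Gamma(s)\sqrt{\frac{2}{s\pi}}\exp\Bigl(\frac{-x^2}{2s}\Bigr)U\Bigl(s-1,\frac12,\frac{x^2}{2s}\Bigr),\quad x>0,$$ where $U(a,b,z)$ is the confluent hypergeometric function of the second kind (Kummer $U$ function): the solution of $z\,U''+(b-z)U'-aU=0$ (derivatives in $z$) with $U(a,b,z)\sim z^{-a}$ as $z\to\infty$. $\mathscr{L}(X)$ is the law of $X$, and $d_{\mathrm K}(P,Q)=\sup_x|P(x)-Q(x)|$ is the Kolmogorov distance between distribution functions $P,Q$. *)

(* Defs.v *)
From HB Require Import structures.
From mathcomp Require Import all_boot all_order all_algebra.
From mathcomp Require Import all_classical all_reals all_analysis.

Set Implicit Arguments.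
Unset Strict Implicit.
Unset Printing Implicit Defensive.

Import Order.TTheory GRing.Theory Num.Theory.
Import numFieldNormedType.Exports.

Local Open Scope classical_set_scope.
Local Open Scope ring_scope.

(* A graph on the vertices 1, ..., n is the list of its directed edges, the most
   recent one first; (u, v) is the edge from u to v. *)
Definition digraph : Type := seq (nat * nat).

HB.instance Definition _ := Choice.on digraph.
HB.instance Definition _ := isPointed.Build digraph [::].
HB.instance Definition _ := @isMeasurable.Build default_measure_display
  digraph discrete_measurable discrete_measurable0
  discrete_measurableC discrete_measurableU.

(* Out-degree plus in-degree: a loop (i, i) is counted in both. *)
Definition degree (i : nat) (g : digraph) : nat :=
  (count (fun e => e.1 == i) g + count (fun e => e.2 == i) g)%N.

Section preferential_attachment.
Context (R : realType).

(* Conditional probability that vertex n.+1 connects to vertex i, given that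
   the graph on {1, ..., n} is g. *)

Definition attach_prob1 (n : nat) (g : digraph) (i : nat) : R :=
  if (1 <= i <= n)%N
  then (degree i g)%:R / (\sum_(1 <= j < n.+1) degree j g)%N%:R
  else 0.

(* The self-connection has probability 1 / (2n + 1); what remains is shared
   among 1, ..., n proportionally to the degrees. *)
Definition attach_prob2 (n : nat) (g : digraph) (i : nat) : R :=
  if (1 <= i <= n)%N
  then (1 - (2 * n + 1)%N%:R^-1)
       * ((degree i g)%:R / (\sum_(1 <= j < n.+1) degree j g)%N%:R)
  else if i == n.+1 then (2 * n + 1)%N%:R^-1
  else 0.

Context d (T : measurableType d) (P : probability T R).

(* The indices n < n0 of G are irrelevant.  Conditioning on G n is conditioning
   on the whole past, as the edge list G n records G n0, ..., G n.-1. *)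
Definition attachment_process (n0 : nat) (g0 : digraph)
    (q : nat -> digraph -> nat -> R) (G : nat -> {RV P >-> digraph}) : Prop :=
  P [set w | G n0 w = g0] = 1%E /\
  forall (n : nat) (g : digraph) (i : nat), (n0 <= n)%N ->
    P [set w | G n w = g /\ G n.+1 w = (n.+1, i) :: g] =
    (P [set w | G n w = g] * (q n g i)%:E)%E.

Definition model1 (G : nat -> {RV P >-> digraph}) : Prop :=
  attachment_process 2 [:: (2, 1)%N] attach_prob1 G.

Definition model2 (G : nat -> {RV P >-> digraph}) : Prop :=
  attachment_process 1 [:: (1, 1)%N] attach_prob2 G.

Variable G : nat -> {RV P >-> digraph}.

Definition W (n i : nat) : T -> R := fun w => (degree i (G n w))%:R.

Definition b (n i : nat) : R := Num.sqrt (fine 'E_P[(fun w => W n i w ^+ 2)]).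

Definition scaledW (n i : nat) : T -> R := fun w => W n i w / b n i.

Lemma measurable_scaledW (n i : nat) : measurable_fun [set: T] (scaledW n i).
Proof.
exact: (@measurableT_comp _ _ _ _ _ _
  (fun g : digraph => (degree i g)%:R / b n i)).
Qed.

HB.instance Definition _ (n i : nat) :=
  isMeasurableFun.Build _ _ _ _ (scaledW n i) (measurable_scaledW n i).

End preferential_attachment.

Arguments model1 {R d T} P G.
Arguments model2 {R d T} P G.
Arguments W {R d T} P G n i.
Arguments b {R d T} P G n i.
Arguments scaledW {R d T} P G n i.

Section limit_law.
Context (R : realType).
Local Notation mu := (@lebesgue_measure R).

Definition Gamma (s : R) : R :=
  \int[mu]_(t in `]0, +oo[) (t `^ (s - 1) * expR (- t)).

(* The conditions determine U on ]0, +oo[; its values elsewhere are junk. *)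
Definition is_kummerU (a b : R) (U : R -> R) : Prop :=
  (forall z : R, 0 < z ->
    [/\ derivable U z 1, derivable (derive1 U) z 1 &
        z * derive1 (derive1 U) z + (b - z) * derive1 U z - a * U z = 0]) /\
  U z / z `^ (- a) @[z --> +oo] --> (1 : R).

Definition kummerU (a b : R) : R -> R := xget (cst 0) [set U | is_kummerU a b U].

Definition kappa (s x : R) : R :=
  Gamma s * Num.sqrt (2 / (s * pi)) * expR (- x ^+ 2 / (2 * s))
  * kummerU (s - 1) 2^-1 (x ^+ 2 / (2 * s)).

Definition K (s x : R) : R := \int[mu]_(t in `]0, x]) kappa s t.

Definition dK (F1 F2 : R -> R) : R := sup (range (fun x => `|F1 x - F2 x|)).

End limit_law.

Definition law_cdf (R : realType) d (T : measurableType d) (P : probability T R)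
  (X : {RV P >-> R}) : R -> R := fun x => fine (cdf X x).

Arguments law_cdf {R d T} P X.

(* Main.v *)
Require Import Defs.
From mathcomp Require Import all_boot all_order all_algebra.
From mathcomp Require Import all_classical all_reals all_analysis.
From mathcomp Require Import ring lra zify.

(** The degree of vertex [i] is a Markov chain [X_0 = 1] that jumps from [x] to
    [x + 1] at step [k] with probability [x / (2 (s + k))], where [s = i - 1] in
    Model 1 and [s = i - 1/2] in Model 2 (there the random loop at [i] is one
    extra step).  Put [q = 2 s - 1], a natural number.  The law is explicit:
    [P (X_k > j) = A_q(k, j) / A_q(k, 0)], where
    [A_0(k, j) = \prod_(i < j) 2 (k - i) / (2 k - i)] and [A_{q+1}] is the tail
    sum of [A_q] in [j].

    In the same way the tail of [K_s] is [I_q(x / sqrt (2 s)) / I_q(0)], where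
    [I_0(t) = exp (- t ^ 2)] and [I_{q+1}] is the tail integral of [I_q]: up to
    the factor [2 ^ (q - 1) exp z], the function [U (s - 1, 1/2, z)] is
    [- I_q^`()] at [sqrt z], by the three-term recurrence of the iterated error
    functions and uniqueness for Kummer's equation (Wronskian).

    With [sigma = 2 sqrt k], [A_0(k, j)] is within [O(1 / sigma) exp (- j / sigma)]
    of [I_0(j / sigma)].  Comparing sums with integrals [q] times gives
    [A_q(k, j) = sigma ^ q (I_q(j / sigma) + O(1 / sigma))], hence the upper
    bound.  For the lower bound, [X_k] is concentrated on [O(sqrt k)] integers,
    so it has an atom of mass at least [c / sqrt k], whereas [K_s] is continuous. *)

Set Implicit Arguments.
Unset Strict Implicit.
Unset Printing Implicit Defensive.

Import Order.TTheory GRing.Theory Num.Theory.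
Import numFieldNormedType.Exports.

Local Open Scope classical_set_scope.
Local Open Scope ring_scope.

(** * The law of the urn *)

Section iterated_tails.
Context {R : realType}.

(** For [j <= k] this is [2 ^ j] times the ratio of the binomial coefficients of [k] out of
    [2 k - j] and of [k] out of [2 k]. The factor [i = k] makes it vanish for [j > k]. *)
Definition ballot (k j : nat) : R :=
  \prod_(i < j) (2 * (k%:R - i%:R) / (2 * k%:R - i%:R)).

(** Stopping the sums at [k] loses nothing, as every level vanishes beyond [k]. *)
Fixpoint itail (q k j : nat) : R :=
  if q is q'.+1 then \sum_(j <= i < k.+1) itail q' k i else ballot k j.

Lemma ballotS k j :
  ballot k j.+1 = ballot k j * (2 * (k%:R - j%:R) / (2 * k%:R - j%:R)).
Proof. by rewrite /ballot big_ord_recr. Qed.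

Lemma ballot0 k : ballot k 0 = 1.
Proof. by rewrite /ballot big_ord0. Qed.

Lemma ballot_gt k j : (k < j)%N -> ballot k j = 0.
Proof.
move=> kj; rewrite /ballot (bigD1 (Ordinal kj)) //= subrr mulr0 mul0r.
by rewrite mul0r.
Qed.

Lemma ballot_gt0 k j : (j <= k)%N -> 0 < ballot k j.
Proof.
move=> jk; apply: prodr_gt0 => i _.
have : (i%:R < k%:R :> R) by rewrite ltr_nat (leq_trans _ jk).
by move=> ik; apply: divr_gt0; have := ler0n R i; lra.
Qed.

Lemma itail0 k j : itail 0 k j = ballot k j.
Proof. by []. Qed.

Lemma itail_sum q k j : itail q.+1 k j = \sum_(j <= i < k.+1) itail q k i.
Proof. by []. Qed.

Arguments itail : simpl never.

Lemma itail_gt q k j : (k < j)%N -> itail q k j = 0.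
Proof.
by case: q => [|q] kj; [exact: ballot_gt | rewrite itail_sum big_geq].
Qed.

Lemma itail_gt0 q k j : (j <= k)%N -> 0 < itail q k j.
Proof.
elim: q j => [|q IH] j jk; first exact: ballot_gt0.
rewrite itail_sum big_ltn ?ltnS //; apply: ltr_pwDl; first exact: IH.
rewrite big_nat; apply: sumr_ge0 => i /andP[_ ik].
by apply/ltW/IH; rewrite -ltnS.
Qed.

Lemma itail_ge0 q k j : 0 <= itail q k j.
Proof.
by have [jk|kj] := leqP j k; [exact/ltW/itail_gt0 | rewrite itail_gt].
Qed.

Lemma itailS q k j : itail q.+1 k j = itail q k j + itail q.+1 k j.+1.
Proof.
have [jk|kj] := leqP j k; first by rewrite !itail_sum big_ltn.
by rewrite !itail_gt ?addr0 // ltnS ltnW.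
Qed.

Lemma itail_nincr q k j : itail q k j.+1 <= itail q k j.
Proof.
case: q => [|q]; last by rewrite (itailS q k j) lerDr itail_ge0.
rewrite !itail0; have [jk|kj] := ltnP j k; last first.
  by rewrite ballot_gt ?ltnS//; exact: (@itail_ge0 0).
rewrite ballotS ger_pMr ?ballot_gt0 1?ltnW //.
have : (j%:R < k%:R :> R) by rewrite ltr_nat.
by move=> jk'; rewrite ler_pdivrMr; have := ler0n R j; lra.
Qed.

(** Apart from its first factor, which is 1, the product on the left has the numerators of
    [ballot k j]; the ratio of the denominators telescopes to [(2 k + 1 - j) / (2 k + 1)]. *)
Lemma ballot_shift k j :
  (2 * k%:R + 1) * ballot k.+1 j.+1 = (2 * k%:R + 1 - j%:R) * ballot k j.
Proof.
have k0 := ler0n R k.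
elim: j => [|j IH].
  rewrite ballotS !ballot0 -natr1; field; lra.
have [jk|kj] := ltnP j k; last first.
  by rewrite !ballot_gt ?mulr0 ?ltnS// ltnW.
have jk' : j%:R < k%:R :> R by rewrite ltr_nat.
rewrite ballotS mulrA IH ballotS -!natr1; field.
by have j0 := ler0n R j; apply/andP; split; lra.
Qed.

(* [predn 0 = 0] is harmless: the second term then vanishes. *)
Lemma itail_step q k j :
  (2 * k%:R + 1) * itail q k.+1 j =
  (2 * k%:R + 1 + q%:R - j%:R) * itail q k j + j%:R * itail q k j.-1.
Proof.
elim: q j => [|q IH] j.
  rewrite !itail0; case: j => [|j] /=; first by rewrite !ballot0; ring.
  rewrite ballot_shift.
  have [jk|kj] := ltnP j k; last first.
    rewrite (@ballot_gt k j.+1) ?ltnS// mulr0 add0r.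
    move: kj; rewrite leq_eqVlt => /predU1P[->|kj].
      by rewrite -natr1; ring.
    by rewrite ballot_gt // !mulr0.
  have jk' : j%:R < k%:R :> R by rewrite ltr_nat.
  rewrite ballotS -natr1; field.
  by have j0 := ler0n R j; lra.
(* Descending induction on [j]: from [k + 2] on all terms vanish, and below that the identity at [j]
   is the one at [j + 1] plus the identity of level [q] at [j]. *)
have [m jm] : exists m, (k.+2 <= j + m)%N by exists k.+2; rewrite leq_addl.
elim: m j jm => [|m IHm] j jm.
  rewrite addn0 in jm.
  have -> : itail q.+1 k j.-1 = 0 by apply: itail_gt; case: (j) jm.
  by rewrite !itail_gt ?mulr0 ?addr0 // ltnW.
have := IHm j.+1; rewrite addSnnS => /(_ jm) /= E.
rewrite itailS mulrDr E IH -!natr1.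
case: j {jm E} => [|j] /=; first by rewrite (itailS q k 0); ring.
rewrite (itailS q k j) (itailS q k j.+1) -!natr1; ring.
Qed.

Lemma itail_norm q k :
  (2 * k%:R + 1) * itail q k.+1 0 = (2 * k%:R + 1 + q%:R) * itail q k 0.
Proof. by rewrite itail_step mul0r addr0 subr0. Qed.

(* If [X_k] is the state of the urn after [k] steps, [surv q k j] is P(X_k > j)
   and [urn_pmf q k j] is P(X_k = j + 1). *)
Definition surv q k j : R := itail q k j / itail q k 0.

Definition urn_pmf q k j : R := surv q k j - surv q k j.+1.

Lemma surv0 q k : surv q k 0 = 1.
Proof. by rewrite /surv divff // gt_eqF // itail_gt0. Qed.

Lemma surv_gt q k j : (k < j)%N -> surv q k j = 0.
Proof. by move=> kj; rewrite /surv itail_gt // mul0r. Qed.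

Lemma surv_ge0 q k j : 0 <= surv q k j.
Proof. by rewrite divr_ge0 // itail_ge0. Qed.

Lemma urn_pmf_ge0 q k j : 0 <= urn_pmf q k j.
Proof.
rewrite subr_ge0 ler_wpM2r ?itail_nincr //.
by rewrite invr_ge0 itail_ge0.
Qed.

(** The transition of the urn: the state exceeds [j] after the step if it did so before, or if it
    was equal to [j] and jumped. This is [itail_step] divided by its case [j = 0]. *)
Lemma survS q k j : surv q k.+1 j =
  surv q k j + j%:R / (2 * k%:R + 1 + q%:R) * (surv q k j.-1 - surv q k j).
Proof.
have k0 := ler0n R k; have q0 := ler0n R q.
have A0 : itail q k 0 != 0 by rewrite gt_eqF // itail_gt0.
have B0 : itail q k.+1 0 != 0 by rewrite gt_eqF // itail_gt0.
rewrite /surv; have EA := itail_step q k j; have EB := itail_norm q k.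
have c1 : 2 * k%:R + 1 != 0 :> R by lra.
have c2 : 2 * k%:R + 1 + q%:R != 0 :> R by lra.
have -> : itail q k.+1 0 = (2 * k%:R + 1 + q%:R) * itail q k 0 / (2 * k%:R + 1).
  by rewrite -EB mulrC mulKf.
have -> : itail q k.+1 j = ((2 * k%:R + 1 + q%:R - j%:R) * itail q k j +
    j%:R * itail q k j.-1) / (2 * k%:R + 1).
  by rewrite -EA mulrC mulKf.
by field; rewrite A0 c1 c2.
Qed.

Lemma urn_pmfS q k j : urn_pmf q k.+1 j =
  urn_pmf q k j * (1 - j.+1%:R / (2 * k%:R + 1 + q%:R))
  + j%:R / (2 * k%:R + 1 + q%:R) * urn_pmf q k j.-1.
Proof.
by case: j => [|j]; rewrite /urn_pmf !survS /=; ring.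
Qed.

Lemma urn_pmf_gt q k j : (k < j)%N -> urn_pmf q k j = 0.
Proof. by move=> kj; rewrite /urn_pmf !surv_gt ?subrr // ltnW. Qed.

Lemma surv_urn_pmf q k j m : (j <= m)%N ->
  \sum_(j <= i < m) urn_pmf q k i = surv q k j - surv q k m.
Proof.
by move=> jm; rewrite -opprB -telescope_sumr // -sumrN;
  apply: eq_bigr => i _; rewrite opprB.
Qed.

Lemma surv_le1 q k j : surv q k j <= 1.
Proof.
by rewrite -subr_ge0 -(surv0 q k) -surv_urn_pmf // sumr_ge0 // => i _; exact: urn_pmf_ge0.
Qed.

(** The expectation of [f] at the state [X_k], which lies between 1 and [k + 1]; [urn_pmf] counts
    the states from 0. *)
Definition urn_expect q k (f : nat -> R) : R :=
  \sum_(j < k.+1) urn_pmf q k j * f j.+1.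

Lemma urn_expect0 q f : urn_expect q 0 f = f 1%N.
Proof. by rewrite /urn_expect big_ord1 /urn_pmf surv0 surv_gt // subr0 mul1r. Qed.

(** The transition moved from the law to the test function, a form that can be matched with
    [graph_expectS]. *)
Lemma urn_expectS q k f : urn_expect q k.+1 f =
  urn_expect q k (fun x => (1 - x%:R / (2 * k%:R + 1 + q%:R)) * f x
                           + x%:R / (2 * k%:R + 1 + q%:R) * f x.+1).
Proof.
rewrite /urn_expect; set c := _ + q%:R.
under eq_bigr do rewrite urn_pmfS mulrDl.
under [RHS]eq_bigr do rewrite mulrDr.
rewrite !big_split /=; congr (_ + _).
  rewrite big_ord_recr /= (@urn_pmf_gt q k k.+1) // !mul0r addr0.
  by apply: eq_bigr => i _; rewrite mulrA.
rewrite big_ord_recl /= !mul0r add0r; apply: eq_bigr => i _ /=.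
by rewrite /bump /= add1n -/c; ring.
Qed.

Lemma urn_expect_cst q k (x : R) : urn_expect q k (fun=> x) = x.
Proof.
rewrite /urn_expect -mulr_suml -(big_mkord xpredT (urn_pmf q k)) surv_urn_pmf //.
by rewrite surv0 surv_gt // subr0 mul1r.
Qed.

Lemma le_urn_expect q k f g : (forall x, (0 < x)%N -> f x <= g x) ->
  urn_expect q k f <= urn_expect q k g.
Proof.
by move=> fg; apply: ler_sum => j _; rewrite ler_wpM2l ?urn_pmf_ge0 ?fg.
Qed.

Lemma urn_expectZ q k (c : R) f :
  urn_expect q k (fun x => c * f x) = c * urn_expect q k f.
Proof. by rewrite /urn_expect mulr_sumr; apply: eq_bigr => j _; ring. Qed.

Lemma urn_expectD q k f g :
  urn_expect q k (fun x => f x + g x) = urn_expect q k f + urn_expect q k g.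
Proof. by rewrite /urn_expect -big_split; apply: eq_bigr => j _ /=; ring. Qed.

Lemma urn_expect_le q k m :
  urn_expect q k (fun x => (x <= m)%:R) = 1 - surv q k m.
Proof.
have [km|mk] := leqP k.+1 m.
  rewrite surv_gt // subr0 -[RHS](urn_expect_cst q k); apply: eq_bigr => j _.
  by rewrite (leq_trans _ km) // ltnS -ltnS.
rewrite /urn_expect -(big_mkord xpredT (fun j => urn_pmf q k j * (j < m)%:R)).
rewrite (big_cat_nat (n := m)) //= ?(ltnW mk) //.
have -> : \sum_(m <= j < k.+1) urn_pmf q k j * (j < m)%:R = 0.
  rewrite big_nat big1 // => j /andP[mj _]; by rewrite ltnNge mj mulr0.
rewrite addr0 -[in RHS](surv0 q k) -surv_urn_pmf // !big_nat; apply: eq_bigr => j jm.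
by rewrite (andP jm).2 mulr1.
Qed.

(** The function [x (x + 1)] is an eigenfunction of the transition, with eigenvalue [1 + 2 / c] for
    [c = 2 k + 1 + q]; the product of the eigenvalues telescopes. *)
Lemma urn_expect_rising2 q k :
  urn_expect q k (fun x => x%:R * (x%:R + 1))
  = 2 * (2 * k%:R + 1 + q%:R) / (1 + q%:R).
Proof.
have q0 := ler0n R q.
elim: k => [|k IH].
  by rewrite urn_expect0; field; lra.
have k0 := ler0n R k.
rewrite urn_expectS; set c := 2 * k%:R + 1 + q%:R.
have c0 : c != 0 by rewrite /c; lra.
rewrite (_ : (fun x => _) = fun x => (1 + 2 / c) * (x%:R * (x%:R + 1))).
  by rewrite urn_expectZ IH -/c -natr1 /c; field; rewrite c0; lra.
by apply/funext => x; rewrite -natr1; field.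
Qed.

End iterated_tails.

Arguments itail : simpl never.

(** * From the graph process to the urn *)

(** A finite support for the graph after [m] steps, which turns expectations into finite sums. The
    new vertex is allowed as its own target, so that one list serves both models. *)
Fixpoint reachable (n0 : nat) (g0 : digraph) (m : nat) : seq digraph :=
  if m is m'.+1 then
    [seq (((n0 + m').+1, i) :: g : digraph) |
      g <- reachable n0 g0 m', i <- iota 1 (n0 + m').+1]
  else [:: g0].

Lemma reachable_uniq n0 g0 m : uniq (reachable n0 g0 m).
Proof.
elim: m => // m IH; apply: (@allpairs_uniq_dep _ (fun=> nat) digraph) => //.
  by move=> g _; exact: iota_uniq.
by move=> [g i] [h j] _ _ [/= -> ->].
Qed.

Definition valid_graph n (g : digraph) :=
  all (fun e => (0 < e.1 <= n) && (0 < e.2 <= n))%N g.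

Lemma degree_cons i n j (g : digraph) :
  degree i ((n, j) :: g) = (degree i g + (n == i) + (j == i))%N.
Proof. by rewrite /degree /=; lia. Qed.

Lemma degree_gt n g i : valid_graph n g -> (n < i)%N -> degree i g = 0%N.
Proof.
move=> /allP vg ni.
have c0 (p : pred (nat * nat)) : {in g, forall e, ~~ p e} -> count p g = 0%N.
  by move=> /hasPn; rewrite has_count -eqn0Ngt => /eqP.
by rewrite /degree !c0 // => e /vg /= eN; lia.
Qed.

(** The handshake lemma: each edge contributes 1 at either end, also when it is a loop. *)
Lemma sum_degree n g : valid_graph n g ->
  (\sum_(1 <= j < n.+1) degree j g = 2 * size g)%N.
Proof.
have sum1 (i : nat) : (0 < i <= n)%N -> (\sum_(1 <= j < n.+1) (i == j) = 1)%N.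
  move=> iN; rewrite (bigD1_seq i) ?iota_uniq ?mem_index_iota //= eqxx.
  by rewrite big1 // => j /negbTE; rewrite eq_sym => ->.
elim: g => [|[u v] g IH] /=; first by rewrite big1.
move=> /andP[/andP[uN vN] vg].
under eq_bigr do rewrite degree_cons.
by rewrite big_split big_split /= !sum1 // IH //; lia.
Qed.

Lemma reachableP n0 g0 m g : valid_graph n0 g0 -> g \in reachable n0 g0 m ->
  valid_graph (n0 + m) g /\ size g = (size g0 + m)%N.
Proof.
move=> vg0; elim: m g => [|m IH] g.
  by rewrite inE => /eqP ->; rewrite !addn0.
move=> /allpairsPdep[h [j [/IH[vh sh] + ->]]].
rewrite mem_iota => jn; split; last by rewrite /= sh addnS.
rewrite /valid_graph /= addnS; apply/andP; split; first by lia.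
by apply: sub_all vh => e /= eN; lia.
Qed.

Section attachment_law.
Context {R : realType} d (T : measurableType d) (P : probability T R).
Variables (n0 : nat) (g0 : digraph) (q : nat -> digraph -> nat -> R).
Variable G : nat -> {RV P >-> digraph}.
Hypothesis PG : attachment_process n0 g0 q G.
Hypothesis q1 : forall m g, g \in reachable n0 g0 m ->
  \sum_(i <- iota 1 (n0 + m).+1) q (n0 + m) g i = 1.

Definition graph_prob n g : R := fine (P [set w | G n w = g]).

Lemma measurable_graph_event n g : measurable [set w | G n w = g].
Proof.
rewrite (_ : [set w | _] = G n @^-1` [set g]) //.
by rewrite -[X in measurable X]setTI; exact: measurable_funP.
Qed.

Lemma graph_probE n g : P [set w | G n w = g] = (graph_prob n g)%:E.
Proof.
by rewrite fineK // fin_num_measure //; exact: measurable_graph_event.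
Qed.

Lemma graph_events_trivIset n (D : set digraph) :
  trivIset D (fun g => [set w | G n w = g]).
Proof. by move=> g h _ _ [w [/= <- <-]]. Qed.

Lemma measurable_graph_fun n (f : digraph -> R) :
  measurable_fun [set: T] (fun w => f (G n w)).
Proof. exact: (@measurableT_comp _ _ _ _ _ _ f). Qed.

Lemma integral_graph_events n (f : digraph -> R) s :
  (forall g, 0 <= f g) -> uniq s ->
  (\int[P]_(w in \big[setU/set0]_(g <- s) [set w | G n w = g]) (f (G n w))%:E
   = (\sum_(g <- s) graph_prob n g * f g)%:E)%E.
Proof.
move=> f0 us; rewrite ge0_integral_bigsetU //.
- rewrite -sumEFin; apply: eq_bigr => g _.
  rewrite (eq_integral (cst (f g)%:E)); last first.
    by move=> w; rewrite inE /= => ->.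
  rewrite integral_cst; last exact: measurable_graph_event.
  by rewrite mulrC EFinM -graph_probE muleC.
- by move=> g; exact: measurable_graph_event.
- exact: graph_events_trivIset.
- apply/measurable_realfun.measurable_EFinP; apply: measurable_funTS.
  exact: measurable_graph_fun.
- by move=> w _; rewrite lee_fin.
Qed.

Lemma graph_events_prob n s : uniq s ->
  P (\big[setU/set0]_(g <- s) [set w | G n w = g])
  = (\sum_(g <- s) graph_prob n g)%:E.
Proof.
move=> us; have -> : \sum_(g <- s) graph_prob n g = \sum_(g <- s) graph_prob n g * 1.
  by apply: eq_bigr => g _; rewrite mulr1.
rewrite -(@integral_graph_events n (fun=> 1) s (fun=> ler01) us).
rewrite integral_cst ?mul1e //.
by apply: bigsetU_measurable => g _; exact: measurable_graph_event.
Qed.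

Lemma graph_prob_sum_le1 n s : uniq s -> \sum_(g <- s) graph_prob n g <= 1.
Proof.
move=> us; rewrite -lee_fin -graph_events_prob //; apply: probability_le1.
by apply: bigsetU_measurable => g _; exact: measurable_graph_event.
Qed.

(** The hypothesis on the process concerns the joint event for two successive graphs. Forgetting the
    earlier graph enlarges the event, so at first only an inequality is available. *)
Lemma graph_prob_ge m g i :
  graph_prob (n0 + m) g * q (n0 + m) g i
  <= graph_prob (n0 + m).+1 (((n0 + m).+1, i) :: g).
Proof.
rewrite -lee_fin EFinM -!graph_probE -(PG.2 _ _ _ (leq_addr _ _)).
apply: le_measure; rewrite ?inE; [|exact: measurable_graph_event|by move=> w []].
rewrite (_ : [set w | _ /\ _] = [set w | G (n0 + m) w = g] `&`
  [set w | G (n0 + m).+1 w = ((n0 + m).+1, i) :: g]) //.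
by apply: measurableI; exact: measurable_graph_event.
Qed.

Lemma sum_reachableS m (F : digraph -> R) :
  \sum_(g <- reachable n0 g0 m.+1) F g = \sum_(g <- reachable n0 g0 m)
    \sum_(i <- iota 1 (n0 + m).+1) F (((n0 + m).+1, i) :: g).
Proof. exact: big_allpairs_dep. Qed.

(* Both sides of [graph_prob_ge] have the same sum 1 over the reachable graphs,
   hence they are equal and no null set has to be discarded. *)
Lemma graph_prob_cons m : \sum_(g <- reachable n0 g0 m) graph_prob (n0 + m) g = 1 ->
  {in reachable n0 g0 m & iota 1 (n0 + m).+1, forall g i,
  graph_prob (n0 + m).+1 (((n0 + m).+1, i) :: g)
  = graph_prob (n0 + m) g * q (n0 + m) g i}.
Proof.
move=> E1 g i gm im.
pose p (x : digraph * nat) := graph_prob (n0 + m).+1 (((n0 + m).+1, x.2) :: x.1).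
pose r (x : digraph * nat) := graph_prob (n0 + m) x.1 * q (n0 + m) x.1 x.2.
pose s := [seq (g, i) | g <- reachable n0 g0 m, i <- iota 1 (n0 + m).+1].
have pr0 x : true -> 0 <= p x - r x by move=> _; rewrite subr_ge0 graph_prob_ge.
have sums0 : \sum_(x <- s) (p x - r x) == 0.
  rewrite eq_le sumr_ge0 ?andbT // sumrB subr_le0.
  have -> : \sum_(x <- s) r x = 1.
    rewrite /s big_allpairs_dep /= -[RHS]E1 big_seq [RHS]big_seq.
    by apply: eq_bigr => h hm; rewrite /r /= -mulr_sumr q1 // mulr1.
  have := graph_prob_sum_le1 (n0 + m).+1 (reachable_uniq n0 g0 m.+1).
  by rewrite sum_reachableS /s big_allpairs_dep.
have := sums0; rewrite psumr_eq0 // => /allP /(_ (g, i)).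
rewrite /= /s (allpairs_f (fun g i => (g, i))) // => /(_ isT).
by rewrite subr_eq0 => /eqP.
Qed.

Lemma sum_graph_prob m : \sum_(g <- reachable n0 g0 m) graph_prob (n0 + m) g = 1.
Proof.
elim: m => [|m IH]; first by rewrite /= big_seq1 addn0 /graph_prob PG.1.
rewrite sum_reachableS addnS -[RHS]IH big_seq [RHS]big_seq.
apply: eq_bigr => g gm; rewrite big_seq.
under eq_bigr do rewrite graph_prob_cons //.
by rewrite -big_seq -mulr_sumr q1 // mulr1.
Qed.

Definition graph_expect m (f : digraph -> R) : R :=
  \sum_(g <- reachable n0 g0 m) graph_prob (n0 + m) g * f g.

Lemma graph_expect0 f : graph_expect 0 f = f g0.
Proof.
by rewrite /graph_expect /= big_seq1 addn0 /graph_prob PG.1 mul1r.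
Qed.

Lemma graph_expectS m f : graph_expect m.+1 f = graph_expect m (fun g =>
  \sum_(i <- iota 1 (n0 + m).+1) q (n0 + m) g i * f (((n0 + m).+1, i) :: g)).
Proof.
rewrite /graph_expect sum_reachableS addnS big_seq [RHS]big_seq.
apply: eq_bigr => g gm; rewrite mulr_sumr big_seq [RHS]big_seq.
apply: eq_bigr => i im; rewrite graph_prob_cons ?sum_graph_prob //.
by rewrite mulrA.
Qed.

Lemma eq_graph_expect m f1 f2 : {in reachable n0 g0 m, f1 =1 f2} ->
  graph_expect m f1 = graph_expect m f2.
Proof.
move=> f12; rewrite /graph_expect big_seq [RHS]big_seq.
by apply: eq_bigr => g gm; rewrite f12.
Qed.

(** By [sum_graph_prob] the event that the graph is not reachable has probability 0, so the integral
    is carried by finitely many events on which the integrand is constant. *)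
Lemma integral_graph_expect m f : (forall g, 0 <= f g) ->
  (\int[P]_w (f (G (n0 + m) w))%:E = (graph_expect m f)%:E)%E.
Proof.
move=> f0; set s := reachable n0 g0 m; have us := reachable_uniq n0 g0 m.
pose D := \big[setU/set0]_(g <- s) [set w | G (n0 + m) w = g].
have mD : measurable D.
  by apply: bigsetU_measurable => g _; exact: measurable_graph_event.
rewrite (@ge0_negligible_integral _ _ _ _ _ (~` D)) //.
- by rewrite setTD setCK integral_graph_events.
- exact: measurableC.
- by apply/measurable_realfun.measurable_EFinP; exact: measurable_graph_fun.
- by move=> w _; rewrite lee_fin.
- apply: eq_trans (probability_setC P mD) _.
  by rewrite graph_events_prob // sum_graph_prob subee.
Qed.

(** Among all targets only [i] itself changes the in-degree of [i]. The boolean summand is the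
    out-degree gained when [i] is the new vertex. *)
Lemma sum_attach_degree m i (f : nat -> R) g :
  g \in reachable n0 g0 m -> (0 < i <= (n0 + m).+1)%N ->
  \sum_(j <- iota 1 (n0 + m).+1)
    q (n0 + m) g j * f (degree i (((n0 + m).+1, j) :: g)) =
  (1 - q (n0 + m) g i) * f (degree i g + ((n0 + m).+1 == i))%N
  + q (n0 + m) g i * f (degree i g + ((n0 + m).+1 == i)).+1.
Proof.
move=> gm iN; set D := (_ + (_ == i))%N.
have iI : i \in iota 1 (n0 + m).+1 by rewrite mem_iota add1n ltnS.
have uI := iota_uniq 1 (n0 + m).+1.
have := q1 gm; move: (iota _ _) iI uI => s iI uI; rewrite !(big_rem i iI) /=.
rewrite degree_cons eqxx addn1 -/D => E.
have -> : 1 - q (n0 + m) g i = \sum_(j <- rem i s) q (n0 + m) g j.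
  by rewrite -E; ring.
rewrite addrC; congr (_ + _); rewrite mulr_suml big_seq [RHS]big_seq.
apply: eq_bigr => j; rewrite mem_rem_uniq // inE => /andP[/negbTE ji _].
by rewrite degree_cons ji addn0.
Qed.

(* The index [r] encodes the initial total weight [r + 1] of the urn. *)
Lemma graph_expect_degree m0 k0 r i :
  (0 < i <= n0 + m0)%N ->
  (forall f, graph_expect m0 (fun g => f (degree i g)) = urn_expect r k0 f) ->
  (forall k g, g \in reachable n0 g0 (m0 + k) ->
    q (n0 + (m0 + k)) g i
    = (degree i g)%:R / (2 * (k0 + k)%:R + 1 + r%:R)) ->
  forall k f, graph_expect (m0 + k) (fun g => f (degree i g))
    = urn_expect r (k0 + k) f.
Proof.
move=> /andP[i0 im0] base qi; elim=> [|k IH] f; first by rewrite !addn0.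
rewrite !addnS graph_expectS urn_expectS -IH; apply: eq_graph_expect => g gk.
have ik : (i < (n0 + (m0 + k)).+1)%N by rewrite ltnS addnA (leq_trans im0) ?leq_addr.
rewrite sum_attach_degree // ?i0 1?ltnW // qi // (gtn_eqF ik) addn0.
by ring.
Qed.

End attachment_law.

(** * The two models as urns *)

Section models.
Context {R : realType} d (T : measurableType d) (P : probability T R).
Variable G : nat -> {RV P >-> digraph}.

Lemma attach_prob1_sum (n : nat) (g : digraph) : (1 < n)%N ->
  valid_graph n g -> size g = n.-1 ->
  \sum_(i <- iota 1 n.+1) attach_prob1 R n g i = 1.
Proof.
move=> n1 vg sg; rewrite -{1}(addn1 n) iotaD big_cat /= big_seq1 add1n.
rewrite /attach_prob1 ltnn andbF addr0 sum_degree // sg.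
rewrite big_seq; under eq_bigr => i.
  by rewrite mem_iota add1n ltnS => ->; over.
rewrite -big_seq -mulr_suml -natr_sum.
have -> : (\sum_(i <- iota 1 n) degree i g = \sum_(1 <= i < n.+1) degree i g)%N.
  by rewrite /index_iota subn1.
by rewrite sum_degree // sg divff // pnatr_eq0 muln_eq0 /=; case: n n1 {vg sg} => [|[]].
Qed.

Lemma attach_prob2_sum (n : nat) (g : digraph) : (0 < n)%N ->
  valid_graph n g -> size g = n ->
  \sum_(i <- iota 1 n.+1) attach_prob2 R n g i = 1.
Proof.
move=> n1 vg sg; rewrite -{1}(addn1 n) iotaD big_cat /= big_seq1 add1n.
rewrite {2}/attach_prob2 ltnn andbF eqxx /attach_prob2.
rewrite big_seq; under eq_bigr => i.
  by rewrite mem_iota add1n ltnS => ->; over.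
rewrite -big_seq -mulr_sumr -mulr_suml -natr_sum.
have -> : (\sum_(i <- iota 1 n) degree i g = \sum_(1 <= i < n.+1) degree i g)%N.
  by rewrite /index_iota subn1.
rewrite sum_degree // sg divff ?mulr1 ?subrK //.
by rewrite pnatr_eq0 muln_eq0 /= -lt0n.
Qed.

(** Vertex [i] enters with degree 1 and makes the total degree [2 (i - 1)]; this initial weight is
    encoded by [2 i - 3]. The remaining [n - i] vertices are the urn steps. *)
Lemma model1_integral i n (f : nat -> R) : model1 P G ->
  (2 <= i <= n)%N -> (forall x, 0 <= f x) ->
  (\int[P]_w (f (degree i (G n w)))%:E = (urn_expect (2 * i - 3) (n - i) f)%:E)%E.
Proof.
move=> PG /andP[i2 ni] f0.
have vg0 : valid_graph 2 [:: (2, 1)%N] by [].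
have q1 m g : g \in reachable 2 [:: (2, 1)%N] m ->
    \sum_(j <- iota 1 (2 + m).+1) attach_prob1 R (2 + m) g j = 1.
  move=> /(reachableP vg0)[vg sg].
  by apply: attach_prob1_sum => //; rewrite sg.
have -> : n = (2 + (i - 2 + (n - i)))%N by lia.
apply: eq_trans (integral_graph_expect PG q1 _ (fun g => f0 (degree i g))) _.
congr (_%:E).
have -> : (2 + (i - 2 + (n - i)) - i = 0 + (n - i))%N by lia.
apply: (graph_expect_degree PG q1) => [|h|k g gk].
- by lia.
(* Vertex 2 belongs to the initial graph. A later vertex arrives in the last step, without a loop,
   and has degree 1 whatever the past. *)
- have {}ih : (exists j, i = j + 3)%N \/ i = 2.
    by case: (eqVneq i 2) => [->|i2']; [right | left; exists (i - 3)%N; lia].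
  rewrite urn_expect0; case: ih => [[j ->]|->]; last by rewrite (graph_expect0 PG).
  have -> : (j + 3 - 2 = j.+1)%N by lia.
  rewrite (graph_expectS PG q1).
  transitivity (graph_expect 2 [:: (2, 1)%N] G j (fun=> h 1)).
    apply: eq_graph_expect => g gj; rewrite (sum_attach_degree q1) //; last by lia.
    have [vg _] := reachableP vg0 gj.
    rewrite (degree_gt vg); last by lia.
    rewrite /attach_prob1 [X in if X then _ else _](_ : _ = false); last by lia.
    rewrite (_ : (_ == _) = true); last by lia.
    by rewrite /= subr0 mul1r mul0r addr0.
  by rewrite /graph_expect -mulr_suml (sum_graph_prob PG q1) mul1r.
- have [vg sg] := reachableP vg0 gk.
  rewrite /attach_prob1 ifT; last by lia.
  rewrite sum_degree // sg; congr (_ / _).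
  rewrite add0n -natrM natr1 -natrD /=; congr (_%:R); lia.
Qed.

(** When vertex [i] arrives, its outgoing half-edge counts as weight 1 beside the total degree
    [2 (i - 1)] of the others. The initial weight is thus [2 i - 1], and the choice of the loop is
    the first of [n - i + 1] urn steps. *)
Lemma model2_integral i n (f : nat -> R) : model2 P G ->
  (1 <= i <= n)%N -> (forall x, 0 <= f x) ->
  (\int[P]_w (f (degree i (G n w)))%:E = (urn_expect (2 * i - 2) (n - i).+1 f)%:E)%E.
Proof.
move=> PG /andP[i1 ni] f0.
have vg0 : valid_graph 1 [:: (1, 1)%N] by [].
have q1 m g : g \in reachable 1 [:: (1, 1)%N] m ->
    \sum_(j <- iota 1 (1 + m).+1) attach_prob2 R (1 + m) g j = 1.
  move=> /(reachableP vg0)[vg sg].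
  by apply: attach_prob2_sum => //; rewrite sg.
have -> : n = (1 + (i - 1 + (n - i)))%N by lia.
apply: eq_trans (integral_graph_expect PG q1 _ (fun g => f0 (degree i g))) _.
congr (_%:E).
have -> : ((1 + (i - 1 + (n - i)) - i).+1 = 1 + (n - i))%N by lia.
apply: (graph_expect_degree PG q1) => [|h|k g gk].
- by lia.
(* Vertex 1 starts with its loop and degree 2, in accordance with the urn of parameter 0, whose
   first jump has probability 1. *)
- have {}ih : (exists j, i = j + 2)%N \/ i = 1.
    by case: (eqVneq i 1) => [->|i2']; [right | left; exists (i - 2)%N; lia].
  rewrite urn_expectS urn_expect0; case: ih => [[j ->]|->]; last first.
    rewrite (graph_expect0 PG) /degree /= addn0 addn1 muln1 subnn !(mulr0, addr0, add0r).
    by rewrite divr1 subrr mul0r mul1r add0r.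
  have -> : (j + 2 - 1 = j.+1)%N by lia.
  rewrite (graph_expectS PG q1).
  set c := RHS.
  transitivity (graph_expect 1 [:: (1, 1)%N] G j (fun=> c)).
    apply: eq_graph_expect => g gj; rewrite (sum_attach_degree q1) //; last by lia.
    have [vg _] := reachableP vg0 gj.
    rewrite (degree_gt vg); last by lia.
    rewrite /attach_prob2 [X in if X then _ else _](_ : _ = false); last by lia.
    rewrite ifT; last by lia.
    rewrite (_ : (_ == _) = true); last by lia.
    rewrite /c /= mul1r.
    have -> : 2 * 0 + 1 + (2 * (j + 2) - 2)%:R = (2 * (1 + j) + 1)%:R :> R.
      by rewrite mulr0 add0r nat1r; congr (_%:R); lia.
    by [].
  by rewrite /graph_expect -mulr_suml (sum_graph_prob PG q1) mul1r.
- have [vg sg] := reachableP vg0 gk.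
  rewrite /attach_prob2 ifT; last by lia.
  rewrite sum_degree // sg /=.
  have -> : 2 * (1 + k)%:R + 1 + (2 * i - 2)%:R = (2 * (1 + (i - 1 + k)) + 1)%:R :> R.
    by rewrite -natrM natr1 -!natrD; congr (_%:R); lia.
  (* With [N] vertices and degree [D], the factor [1 - 1 / (2 N + 1)] cancels the total degree [2 N]
     and leaves [D / (2 N + 1)]. *)
  have : 0 < (1 + (i - 1 + k))%:R :> R by rewrite ltr0n.
  move: (1 + _)%N (degree i g) => N D N0; rewrite (natrD _ (2 * N)%N) !natrM; field.
  by rewrite (gt_eqF N0) gt_eqF // addr_gt0 ?mulr_gt0.
Qed.

End models.

(** * Iterated tail integrals of the Gaussian *)

Section calculus.
Context {R : realType}.
Implicit Types f g df : R -> R.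

Lemma is_derive_add f g (x a b : R) : is_derive x 1 f a -> is_derive x 1 g b ->
  is_derive x 1 (fun y => f y + g y) (a + b).
Proof. by move=> fa gb; exact: is_deriveD. Qed.

Lemma is_derive_sub f g (x a b : R) : is_derive x 1 f a -> is_derive x 1 g b ->
  is_derive x 1 (fun y => f y - g y) (a - b).
Proof. by move=> fa gb; exact: is_deriveB. Qed.

Lemma is_derive_mul f g (x a b : R) : is_derive x 1 f a -> is_derive x 1 g b ->
  is_derive x 1 (fun y => f y * g y) (f x * b + g x * a).
Proof. by move=> fa gb; exact: is_deriveM. Qed.

Lemma is_derive_scale f (k x a : R) : is_derive x 1 f a ->
  is_derive x 1 (fun y => k * f y) (k * a).
Proof. by move=> fa; exact: (@is_deriveZ _ _ _ f k). Qed.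

Lemma is_derive_ext f g (x a b : R) : is_derive x 1 f a -> f =1 g -> a = b ->
  is_derive x 1 g b.
Proof. by move=> fa /funext <- <-. Qed.

Lemma is_derive_inv f (x a : R) : is_derive x 1 f a -> f x != 0 ->
  is_derive x 1 (fun y => (f y)^-1) (- a / f x ^+ 2).
Proof.
move=> fa f0; apply: is_derive_ext (is_deriveV f0 fa) (fun=> erefl _) _.
by rewrite mulNr -mulrN mulrC.
Qed.

Lemma is_derive_expR_comp f (x a : R) : is_derive x 1 f a ->
  is_derive x 1 (fun y => expR (f y)) (a * expR (f x)).
Proof.
move=> fa; have := @is_derive1_comp _ expR f x _ _ (is_derive_expR _) fa.
by move/is_derive_ext; apply => //; exact: mulrC.
Qed.

Lemma is_derive_expR_sqr (x : R) :
  is_derive x 1 (fun y => expR (- y ^+ 2)) (- (2 * x) * expR (- x ^+ 2)).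
Proof.
apply: is_derive_expR_comp.
apply: is_derive_ext (is_derive_sub (is_derive_cst 0 x 1)
  (is_derive_mul (is_derive_id x 1) (is_derive_id x 1))) _ _ => [y|].
  by rewrite sub0r expr2.
by rewrite /=; ring.
Qed.

Lemma MVT_pointwise f df (a b : R) : a <= b ->
  (forall x, a <= x <= b -> is_derive x 1 f (df x)) ->
  exists2 c, a <= c <= b & f b - f a = df c * (b - a).
Proof.
move=> ab fdf; have [||c cab E] := @MVT_segment _ f df a b ab.
- by move=> x; rewrite in_itv /= => /andP[/ltW ax /ltW xb]; apply: fdf; rewrite ax xb.
- apply: derivable_within_continuous => x xab.
  have {}xab : a <= x <= b by rewrite in_itv in xab.
  by case: (fdf x xab).
- by exists c => //; rewrite in_itv in cab.
Qed.

Lemma decreasing_to_ge0 f df (a : R) :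
  (forall x, a <= x -> is_derive x 1 f (df x)) ->
  (forall x, a <= x -> df x <= 0) ->
  f x @[x --> +oo] --> (0 : R) -> forall x, a <= x -> 0 <= f x.
Proof.
move=> fdf df0 f0 x ax; apply: (cvgr_to_le f0).
near=> y; have xy : x <= y by near: y; apply: nbhs_pinfty_ge; exact: num_real.
have [|c /andP[xc cy] E] := @MVT_pointwise f df x y xy.
  by move=> z /andP[xz _]; apply: fdf; exact: le_trans xz.
rewrite -subr_le0 E mulr_le0_ge0 ?subr_ge0 //.
by apply: df0; exact: le_trans xc.
Unshelve. all: by end_near. Qed.

Lemma eq_cvg_pinfty f g (a l : R) : (forall t, a <= t -> g t = f t) ->
  g t @[t --> +oo] --> l -> f t @[t --> +oo] --> l.
Proof.
move=> fg gl; apply: cvg_trans _ gl; apply: near_eq_cvg.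
by near=> t; apply: fg; near: t; apply: nbhs_pinfty_ge; exact: num_real.
Unshelve. all: by end_near. Qed.

Lemma cvg_expRN_lin (C : R) : C * expR (- x) @[x --> +oo] --> (0 : R).
Proof. by rewrite -(mulr0 C); apply: cvgM; [exact: cvg_cst | exact: cvgr_expR]. Qed.

Lemma cvg_inv_pinfty : x^-1 @[x --> +oo] --> (0 : R).
Proof.
apply/(@gtr0_cvgV0 _ _ (pinfty_nbhs R) _ id); last exact: cvg_id.
by near=> x; near: x; exact: nbhs_pinfty_gt.
Unshelve. all: by end_near. Qed.

Lemma cvg_exprn_expRN n : x ^+ n * expR (- x) @[x --> +oo] --> (0 : R).
Proof.
apply: (@squeeze_cvgr _ _ _ _ (fun=> 0) (fun x : R => n.+1`!%:R * x^-1)).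
- near=> x; have x0 : 0 < x by near: x; exact: nbhs_pinfty_gt.
  rewrite mulr_ge0 ?expR_ge0 ?exprn_ge0 ?(ltW x0) //= expRN.
  rewrite ler_pdivrMr ?expR_gt0 //.
  have le_exp := expR_ge1Dxn n (ltW x0).
  apply: le_trans (_ : n.+1`!%:R / x * (x ^+ n.+1 / n.+1`!%:R) <= _); last first.
    rewrite ler_wpM2l ?divr_ge0 ?(ltW x0) //.
    by apply: le_trans le_exp; rewrite lerDr.
  rewrite exprS; have f0 : n.+1`!%:R != 0 :> R by rewrite pnatr_eq0 -lt0n fact_gt0.
  move: (n.+1`!%:R) f0 (x ^+ n) => c c0 p.
  by rewrite le_eqVlt; apply/orP; left; apply/eqP; field; rewrite c0 gt_eqF.
- exact: cvg_cst.
- by rewrite -(mulr0 (n.+1`!%:R)); apply: cvgM; [exact: cvg_cst | exact: cvg_inv_pinfty].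
Unshelve. all: by end_near. Qed.

End calculus.

(** * The functions [igauss]: recurrence, derivatives, decay *)

Section iterated_gauss.
Context {R : realType}.
Local Notation mu := (@lebesgue_measure R).

(* The lower bound -1 makes 0 an interior point. *)
Definition gauss_tail (t : R) : R :=
  Num.sqrt pi / 2 + \int[mu]_(x in `[-1, 0]) gauss_fun x
  - \int[mu]_(x in `[-1, t]) gauss_fun x.

(* igauss n.+1 is the n-fold tail integral of exp(-t^2) on [0, +oo[, and
   igauss n = - (igauss n.+1)^`(); the recursion avoids iterated integrals. *)
Fixpoint igauss (n : nat) (t : R) : R :=
  match n with
  | 0 => 2 * t * expR (- t ^+ 2)
  | n1.+1 => match n1 with
    | 0 => expR (- t ^+ 2)
    | n2.+1 => if n2 == 0%N then gauss_tail t
               else (igauss n2 t - 2 * t * igauss n1 t) / (2 * n2%:R)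
    end
  end.

Lemma integrable_gauss_itv (a b : R) : mu.-integrable `[a, b] (EFin \o gauss_fun).
Proof.
apply: (integrableS measurableT) => //; exact: integrableT_gauss.
Qed.

Lemma is_derive_gauss_tail (t : R) : -1 < t ->
  is_derive t 1 gauss_tail (- expR (- t ^+ 2)).
Proof.
move=> t1; have tt : t < t + 1 by lra.
have [d1 d2] := continuous_FTC1_closed tt (integrable_gauss_itv _ _) t1
  (@continuous_gauss_fun R t).
have D : is_derive t 1 (fun t => \int[mu]_(x in `[-1, t]) gauss_fun x)
  (gauss_fun t).
  by rewrite -d2 derive1E; exact: derivableP.
apply: is_derive_ext (is_derive_sub (is_derive_cst _ t 1) D) _ _ => //.
by rewrite sub0r.
Qed.

Lemma gauss_tail0 : gauss_tail 0 = Num.sqrt pi / 2.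
Proof. by rewrite /gauss_tail addrK. Qed.

Lemma gauss_tailE (t : R) : 0 <= t ->
  gauss_tail t = Num.sqrt pi / 2 - gauss_integral_proof.integral0_gauss t.
Proof.
move=> t0; rewrite /gauss_tail /gauss_integral_proof.integral0_gauss.
rewrite -(@Rintegral_itv_obnd_cbnd _ 0); last first.
  apply: (integrableS measurableT) => //; exact: integrableT_gauss.
rewrite -(@Rintegral_itvB _ _ (BLeft (-1)) (BRight t) 0); first by ring.
- exact: integrable_gauss_itv.
- by rewrite bnd_simp; lra.
- by rewrite bnd_simp.
Qed.

(** The known limit [pi / 4] of the square of the Gaussian integral over [[0, t]] yields the limit
    of the integral itself by taking roots. *)
Lemma cvg_gauss_tail : gauss_tail t @[t --> +oo] --> 0.
Proof.
have cvg_Ig : gauss_integral_proof.integral0_gauss t @[t --> +oo]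
    --> (Num.sqrt pi / 2 : R).
  have : Num.sqrt (gauss_integral_proof.integral0_gauss t ^+ 2) @[t --> +oo]
      --> Num.sqrt (pi / 4 : R).
    apply: continuous_cvg; first exact: sqrt_continuous.
    exact: gauss_integral_proof.cvg_integral0_gauss_sqr.
  have -> : Num.sqrt (pi / 4) = Num.sqrt pi / 2 :> R.
    rewrite sqrtrM ?pi_ge0 // sqrtrV // (_ : 4 = 2 ^+ 2 :> R) ?sqrtr_sqr ?ger0_norm //.
    by ring.
  under eq_fun do rewrite sqrtr_sqr ger0_norm
    ?gauss_integral_proof.integral0_gauss_ge0 //.
  exact.
apply: (@eq_cvg_pinfty _ _ (fun t => Num.sqrt pi / 2 -
  gauss_integral_proof.integral0_gauss t) 0) => [t t0|].
  by rewrite gauss_tailE.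
by rewrite -(subrr (Num.sqrt pi / 2)); apply: cvgB => //; exact: cvg_cst.
Qed.

(** The three-term recurrence of the iterated error functions; [igauss 0] is chosen so that it also
    holds at [n = 0]. *)
Lemma igauss_rec n t :
  2 * n%:R * igauss n.+2 t = igauss n t - 2 * t * igauss n.+1 t.
Proof.
case: n => [|n]; first by rewrite mulr0 mul0r subrr.
rewrite [igauss n.+3 _]/=.
by rewrite [LHS]mulrC divfK // mulf_neq0 ?pnatr_eq0.
Qed.

Lemma igaussSS n t :
  igauss n.+3 t = (igauss n.+1 t - 2 * t * igauss n.+2 t) / (2 * n.+1%:R).
Proof. by []. Qed.

Arguments igauss : simpl never.

(** Strong induction: differentiate the recurrence that defines the function, then use the
    recurrence one level lower to collect the terms. *)
Lemma is_derive_igauss n (t : R) : -1 < t ->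
  is_derive t 1 (igauss n.+1) (- igauss n t).
Proof.
move=> t1; elim/ltn_ind: n => -[|[|n]] IH.
- have := is_derive_expR_sqr t; move/is_derive_ext; apply=> //.
  by rewrite /igauss mulNr.
- exact: is_derive_gauss_tail.
- have d1 := IH n (ltnW (ltnSn _)); have d2 := IH n.+1 (ltnSn _).
  have := is_derive_scale (2 * n.+1%:R)^-1 (is_derive_sub d1
    (is_derive_mul (is_derive_scale 2 (is_derive_id t 1)) d2)).
  move/is_derive_ext; apply => [y|]; first by rewrite igaussSS mulrC.
  have n0 := ler0n R n.
  have -> : igauss n t = 2 * n%:R * igauss n.+2 t + 2 * t * igauss n.+1 t.
    by rewrite igauss_rec subrK.
  by rewrite -natr1; field; lra.
Qed.

Lemma igauss0_ge0 (t : R) : 0 <= t -> 0 <= igauss 0 t.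
Proof. by move=> t0; rewrite /igauss !mulr_ge0 ?expR_ge0. Qed.

Lemma expR_sqr_le (t : R) : expR (- t ^+ 2) <= expR 1 * expR (- (2 * t)).
Proof. by rewrite -expRD ler_expR; have := sqr_ge0 (t - 1); lra. Qed.

(** The bound [exp (- t)] is its own tail integral, so it passes from one level to the next with the
    same constant. *)
Definition exp_bounded (f : R -> R) := (forall t, 0 <= t -> 0 <= f t) /\
  exists2 C : R, 0 < C & forall t, 0 <= t -> f t <= C * expR (- t).

(** Both [igauss n.+1] and [C * expR (- t) - igauss n.+1 t] are nonincreasing with limit 0, hence
    nonnegative. *)
Lemma exp_bounded_igaussS n : igauss n.+1 t @[t --> +oo] --> (0 : R) ->
  exp_bounded (igauss n) -> exp_bounded (igauss n.+1).
Proof.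
move=> cvg0 [n0 [C C0 nC]].
have gt_m1 (t : R) : 0 <= t -> -1 < t by lra.
split.
  apply: (@decreasing_to_ge0 _ _ (fun t => - igauss n t)) => // t t0.
    by apply: is_derive_igauss; exact: gt_m1.
  by rewrite oppr_le0 n0.
exists C => // t t0; rewrite -subr_ge0; move: t t0.
apply: (@decreasing_to_ge0 _ _
  (fun t => C * (-1 * expR (- t)) - - igauss n t)) => [t t0|t t0|].
- apply: is_derive_sub; last by apply: is_derive_igauss; exact: gt_m1.
  by apply/is_derive_scale/is_derive_expR_comp; exact: is_deriveNid.
- by have := nC t t0; lra.
- rewrite -(subr0 0); apply: cvgB => //; exact: cvg_expRN_lin.
Qed.

Lemma exp_bounded_cvg0 f : exp_bounded f -> f t @[t --> +oo] --> (0 : R).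
Proof.
move=> [f0 [C C0 fC]]; apply: (@squeeze_cvgr _ _ _ _ (fun=> 0)
  (fun t => C * expR (- t))); last exact: cvg_expRN_lin; last exact: cvg_cst.
near=> t; have t0 : 0 <= t by near: t; apply: nbhs_pinfty_ge; exact: num_real.
by rewrite f0 // fC.
Unshelve. all: by end_near. Qed.

Lemma exp_bounded_cvg0M f n : exp_bounded f -> t ^+ n * f t @[t --> +oo] --> (0 : R).
Proof.
move=> [f0 [C C0 fC]]; apply: (@squeeze_cvgr _ _ _ _ (fun=> 0)
  (fun t => C * (t ^+ n * expR (- t)))); last first.
- by rewrite -(mulr0 C); apply: cvgM; [exact: cvg_cst | exact: cvg_exprn_expRN].
- exact: cvg_cst.
near=> t; have t0 : 0 <= t by near: t; apply: nbhs_pinfty_ge; exact: num_real.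
by rewrite mulr_ge0 ?f0 ?exprn_ge0 //= mulrCA ler_wpM2l ?fC ?exprn_ge0.
Unshelve. all: by end_near. Qed.

Lemma exp_bounded_igauss n : exp_bounded (igauss n).
Proof.
elim/ltn_ind: n => -[|[|[|n]]] IH.
- split; first exact: igauss0_ge0.
  exists (2 * expR 1); first by rewrite mulr_gt0 ?expR_gt0.
  move=> t t0; rewrite /igauss.
  apply: le_trans (_ : 2 * t * (expR 1 * expR (- (2 * t))) <= _).
    by rewrite ler_wpM2l ?expR_sqr_le ?mulr_ge0.
  have -> : - (2 * t) = - t + - t by ring.
  rewrite expRD; have t1 : t * expR (- t) <= 1.
    rewrite expRN ler_pdivrMr ?expR_gt0 // mul1r.
    by have := expR_ge1Dx t; lra.
  have -> : 2 * t * (expR 1 * (expR (- t) * expR (- t))) =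
    2 * expR 1 * expR (- t) * (t * expR (- t)) by ring.
  by apply: ler_piMr => //; rewrite !mulr_ge0 ?expR_ge0.
- split=> [t _|]; first exact: expR_ge0.
  exists (expR 1); first exact: expR_gt0.
  move=> t t0; rewrite /igauss; apply: le_trans (expR_sqr_le t) _.
  by rewrite ler_wpM2l ?expR_ge0 // ler_expR; lra.
- by apply: exp_bounded_igaussS; [exact: cvg_gauss_tail | exact: IH].
(* The limit 0 at this level comes from the recurrence, as [t * igauss n.+2 t] tends to 0 by the
   bound already proved. *)
- apply: exp_bounded_igaussS; last exact: IH.
  have b1 := exp_bounded_cvg0 (IH n.+1 (ltnW (ltnSn _))).
  have b2 := exp_bounded_cvg0M 1 (IH n.+2 (ltnSn _)).
  under eq_fun do rewrite igaussSS.
  have -> : 0 = (0 - 2 * 0) / (2 * n.+1%:R) :> R by rewrite mulr0 subrr mul0r.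
  apply: cvgM; last exact: cvg_cst.
  apply: cvgB => //; under eq_fun do rewrite -mulrA.
  by apply: cvgM => //; exact: cvg_cst.
Qed.

Lemma igauss_ge0 n (t : R) : 0 <= t -> 0 <= igauss n t.
Proof. by have [+ _] := exp_bounded_igauss n; exact. Qed.

Lemma igauss_gt0 n (t : R) : 0 <= t -> 0 < igauss n.+1 t.
Proof.
elim: n t => [|n IH] t t0; first exact: expR_gt0.
have [||c /andP[tc _] E] := @MVT_pointwise _ (igauss n.+2)
  (fun t => - igauss n.+1 t) t (t + 1); first by lra.
  by move=> x /andP[tx _]; apply: is_derive_igauss; lra.
have := igauss_ge0 n.+2 (_ : 0 <= t + 1); have := IH c (le_trans t0 tc); lra.
Qed.

Lemma igauss_bound n : exists2 C : R, 0 < C &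
  forall t, 0 <= t -> igauss n t <= C * expR (- t).
Proof. by have [_] := exp_bounded_igauss n. Qed.

Lemma cvg_igauss n : igauss n t @[t --> +oo] --> (0 : R).
Proof. exact/exp_bounded_cvg0/exp_bounded_igauss. Qed.

Lemma igauss_rec_ge n (t : R) : 0 <= t -> 2 * t * igauss n.+1 t <= igauss n t.
Proof.
move=> t0; rewrite -subr_ge0 -igauss_rec mulr_ge0 // igauss_ge0 //.
Qed.

(** In the recurrence, [igauss n.+2 t] is at most [igauss n.+1 t / (2 * t)] by [igauss_rec_ge] one
    level up. *)
Lemma igauss_rec_le n (t : R) : 0 < t ->
  igauss n t <= 2 * t * igauss n.+1 t * (1 + 2 * n%:R / (2 * t) ^+ 2).
Proof.
move=> t0; rewrite mulrDr mulr1 -lerBlDl -igauss_rec.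
have -> : 2 * t * igauss n.+1 t * (2 * n%:R / (2 * t) ^+ 2)
  = 2 * n%:R * (igauss n.+1 t / (2 * t)) by field; rewrite gt_eqF.
rewrite ler_wpM2l ?mulr_ge0 // ler_pdivlMr; last by lra.
by rewrite mulrC igauss_rec_ge // ltW.
Qed.

Lemma continuous_igauss n (t : R) : -1 < t -> {for t, continuous (igauss n)}.
Proof.
move=> t1; case: n => [|n]; last first.
  apply: differentiable_continuous; apply/derivable1_diffP.
  by case: (is_derive_igauss n t1).
have := is_derive_mul (is_derive_scale 2 (is_derive_id t 1)) (is_derive_expR_sqr t).
by case=> d _; apply: differentiable_continuous; exact/derivable1_diffP.
Qed.

End iterated_gauss.

Arguments igauss : simpl never.

(** * Kummer's equation *)

Section kummer.
Context {R : realType}.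

Lemma is_derive_comp f (g : R -> R) (x a c : R) : is_derive (g x) 1 f a ->
  is_derive x 1 g c -> is_derive x 1 (fun y => f (g y)) (a * c).
Proof. by move=> fa gc; exact: is_derive1_comp. Qed.

Lemma is_derive_continuous (f : R -> R) (x a : R) :
  is_derive x 1 f a -> {for x, continuous f}.
Proof.
by case=> d _; apply: differentiable_continuous; exact/derivable1_diffP.
Qed.

Lemma sqrtr_gtN1 (z : R) : -1 < Num.sqrt z.
Proof. by have := sqrtr_ge0 z; lra. Qed.

(** Up to a constant factor this is [U ((n - 1) / 2, 1/2, z)]. *)
Definition kummer_sol (n : nat) (z : R) : R := expR z * igauss n (Num.sqrt z).

(** For positive [n], the recurrence splits the derivative of [igauss n] into two terms, one of
    which cancels the derivative of [expR z]. For [n = 0] the function is [2 * Num.sqrt z]. *)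
Lemma is_derive_kummer_sol n (z : R) : 0 < z ->
  is_derive z 1 (kummer_sol n) ((1 - n%:R) * kummer_sol n.+1 z / Num.sqrt z).
Proof.
move=> z0; have r0 : 0 < Num.sqrt z by rewrite sqrtr_gt0.
have ds := is_derive1_sqrt z0.
case: n => [|n].
  have d := is_derive_scale 2 ds.
  apply: near_eq_is_derive (is_derive_ext d (fun=> erefl _) _).
    near=> y; have y0 : 0 < y by near: y; exact: lt_nbhsr.
    rewrite /kummer_sol /igauss sqr_sqrtr ?(ltW y0) // mulrCA -expRD subrr.
    by rewrite expR0 mulr1.
  rewrite /kummer_sol /igauss sqr_sqrtr ?(ltW z0) // -expRD subrr expR0.
  by field; rewrite gt_eqF.
have d := is_derive_mul (is_derive_expR z)
  (is_derive_comp (is_derive_igauss n (sqrtr_gtN1 z)) ds).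
apply: is_derive_ext d (fun=> erefl _) _; rewrite /kummer_sol.
have -> : igauss n (Num.sqrt z) = 2 * n%:R * igauss n.+2 (Num.sqrt z)
    + 2 * Num.sqrt z * igauss n.+1 (Num.sqrt z) by rewrite igauss_rec subrK.
by rewrite -natr1; field; rewrite gt_eqF.
Unshelve. all: by end_near. Qed.

Lemma kummer_sol_gt0 n (z : R) : 0 < z -> 0 < kummer_sol n z.
Proof.
move=> z0; rewrite mulr_gt0 ?expR_gt0 //.
case: n => [|n]; last by rewrite igauss_gt0 // sqrtr_ge0.
by rewrite /igauss !mulr_gt0 ?sqrtr_gt0 ?expR_gt0.
Qed.

(** The right side is [kummer_sol 0 z], and for [z >= 1] the sequence is nonincreasing in [n] by
    [igauss_rec_ge]. *)
Lemma kummer_sol_le n (z : R) : 1 <= z -> kummer_sol n z <= 2 * Num.sqrt z.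
Proof.
move=> z1; have s1 : 1 <= Num.sqrt z by rewrite -sqrtr1 ler_wsqrtr.
have -> : 2 * Num.sqrt z = kummer_sol 0 z.
  rewrite /kummer_sol /igauss sqr_sqrtr ?(le_trans _ z1) // mulrCA -expRD subrr.
  by rewrite expR0 mulr1.
rewrite /kummer_sol ler_pM2l ?expR_gt0 //; elim: n => // n; apply: le_trans.
apply: le_trans (igauss_rec_ge n (ltW (lt_le_trans ltr01 s1))).
by rewrite ler_peMl ?igauss_ge0 ?sqrtr_ge0 //; lra.
Qed.

Lemma cvg_sqrt_pinfty : Num.sqrt z @[z --> +oo] --> (+oo : set_system R).
Proof.
apply/cvgryPge => A; near=> z.
apply: le_trans (ler_norm A) _; rewrite -sqrtr_sqr; apply: ler_wsqrtr.
by near: z; apply: nbhs_pinfty_ge; exact: num_real.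
Unshelve. all: by end_near. Qed.

(** This is the asymptotic behaviour required of [U]. The bounds [igauss_rec_ge] and [igauss_rec_le]
    squeeze [r n.+1 t] between [r n t / (1 + 2 n / (2 t) ^ 2)] and [r n t]. *)
Lemma cvg_igauss_ratio n :
  expR (t ^+ 2) * igauss n t * (2 * t) ^+ n / (2 * t) @[t --> +oo] --> (1 : R).
Proof.
pose r n (t : R) := expR (t ^+ 2) * igauss n t * (2 * t) ^+ n / (2 * t).
rewrite -[X in X @ _ --> _]/(r n); elim: n => [|n IH].
  apply: (@eq_cvg_pinfty _ _ (fun=> 1) 1) => [t t1|]; last exact: cvg_cst.
  rewrite /r /igauss expr0 mulr1 mulrCA -expRD subrr expR0 mulr1 divff //.
  by rewrite gt_eqF; lra.
have cinv : (2 * t)^-1 @[t --> +oo] --> (0 : R).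
  under eq_fun do rewrite invfM; rewrite -(mulr0 (2^-1)).
  by apply: cvgM; [exact: cvg_cst | exact: cvg_inv_pinfty].
apply: (@squeeze_cvgr _ _ _ _
  (fun t => r n t / (1 + 2 * n%:R * ((2 * t)^-1 * (2 * t)^-1))) (r n)) => //.
- near=> t; have t0 : 0 < t by near: t; exact: nbhs_pinfty_gt.
  have e0 := expR_gt0 (t ^+ 2); have p0 : 0 < (2 * t) ^+ n.
    by rewrite exprn_gt0 // mulr_gt0.
  have -> : r n.+1 t = expR (t ^+ 2) * (2 * t) ^+ n / (2 * t)
      * (2 * t * igauss n.+1 t).
    by rewrite /r (exprS (2 * t)); move: ((2 * t) ^+ n) => p; field; rewrite gt_eqF.
  have -> : r n t = expR (t ^+ 2) * (2 * t) ^+ n / (2 * t) * igauss n t.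
    by rewrite /r; move: ((2 * t) ^+ n) => p; field; rewrite gt_eqF.
  have c0 : 0 < expR (t ^+ 2) * (2 * t) ^+ n / (2 * t).
    by rewrite divr_gt0 ?mulr_gt0.
  have q0 : 0 < 1 + 2 * n%:R * ((2 * t)^-1 * (2 * t)^-1).
    by rewrite ltr_wpDr // !mulr_ge0 // invr_ge0; lra.
  apply/andP; split; last by rewrite ler_pM2l // igauss_rec_ge // ltW.
  rewrite ler_pdivrMr // -[leRHS]mulrA ler_pM2l //.
  by have := igauss_rec_le n t0; rewrite expr2 invfM.
- rewrite -[X in _ --> X]divr1; apply: cvgM => //; apply: cvgV => //.
  rewrite -[X in _ --> X]addr0; apply: cvgD; first exact: cvg_cst.
  rewrite -(mulr0 (2 * n%:R)) -[in X in _ --> X](mulr0 0).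
  by apply: cvgM; [exact: cvg_cst | exact: cvgM].
Unshelve. all: by end_near. Qed.

End kummer.

(** * The Wronskian of two solutions of Kummer's equation *)

Section kummer_uniqueness.
Context {R : realType}.

Lemma derivable_is_derive (f : R -> R) (x : R) :
  derivable f x 1 -> is_derive x 1 f (derive1 f x).
Proof. by move=> d; rewrite derive1E; exact: derivableP. Qed.

Lemma is_derive_derive1 (f : R -> R) (x a : R) :
  is_derive x 1 f a -> derive1 f x = a.
Proof. by move=> d; rewrite derive1E derive_val. Qed.

Lemma is_derive0_cst_pos (f : R -> R) : (forall z : R, 0 < z -> is_derive z 1 f 0) ->
  forall x y, 0 < x -> 0 < y -> f x = f y.
Proof.
move=> f0 x y x0 y0; wlog xy : x y x0 y0 / x <= y.
  by move=> h; case: (leP x y) => [|/ltW] xy; [|symmetry]; exact: h.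
have [|c _] := @MVT_pointwise _ f (fun=> 0) x y xy.
  by move=> z /andP[xz _]; apply: f0; exact: lt_le_trans xz.
by rewrite mul0r => /eqP; rewrite subr_eq0 => /eqP.
Qed.

(* The Wronskian of two solutions is a multiple of [exp(z) z^(-1/2)]; if it is
   nonzero, the quotient of the solutions moves by a fixed amount on every
   [[z, z + 1]] and cannot converge. *)
Lemma kummer_wronskian (a : R) (U V : R -> R) :
  is_kummerU a 2^-1 U -> is_kummerU a 2^-1 V ->
  exists c, forall z : R, 0 < z ->
    U z * derive1 V z - V z * derive1 U z = c * (expR z / Num.sqrt z).
Proof.
move=> [UODE _] [VODE _].
(* Abel's identity: Kummer's equation with [b = 1/2] gives [w' = (1 - 1 / (2 z)) w] for the
   Wronskian [w], and this product removes the exponential solution. *)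
pose om z := (U z * derive1 V z - V z * derive1 U z) * (expR (- z) * Num.sqrt z).
have om0 (z : R) : 0 < z -> is_derive z 1 om 0.
  move=> z0; have [dU ddU EU] := UODE z z0; have [dV ddV EV] := VODE z z0.
  have r0 : 0 < Num.sqrt z by rewrite sqrtr_gt0.
  have d1 := is_derive_sub
    (is_derive_mul (derivable_is_derive dU) (derivable_is_derive ddV))
    (is_derive_mul (derivable_is_derive dV) (derivable_is_derive ddU)).
  have dexp : is_derive z 1 (fun z : R => expR (- z)) (-1 * expR (- z)).
    by apply: is_derive_expR_comp; exact: is_deriveNid.
  have d2 := is_derive_mul dexp (is_derive1_sqrt z0).
  apply: is_derive_ext (is_derive_mul d1 d2) (fun=> erefl _) _.
  set e := expR (- z); set u' := derive1 U z; set v' := derive1 V z.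
  transitivity ((U z * v' - V z * u') * (e / (2 * Num.sqrt z)
      + Num.sqrt z * (-1 * e)) + e * Num.sqrt z *
      ((U z * derive1 (derive1 V) z + v' * u') -
       (V z * derive1 (derive1 U) z + u' * v'))); first by [].
  have zE : z = Num.sqrt z ^+ 2 by rewrite sqr_sqrtr ?ltW.
  have EU' : derive1 (derive1 U) z = (a * U z - (2^-1 - z) * derive1 U z) / z.
    apply/(mulIf (lt0r_neq0 z0)); rewrite mulfVK ?gt_eqF //.
    by move: EU => /eqP; rewrite subr_eq0 => /eqP <-; ring.
  have EV' : derive1 (derive1 V) z = (a * V z - (2^-1 - z) * derive1 V z) / z.
    apply/(mulIf (lt0r_neq0 z0)); rewrite mulfVK ?gt_eqF //.
    by move: EV => /eqP; rewrite subr_eq0 => /eqP <-; ring.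
  rewrite EU' EV' {EU EV EU' EV'}; move: (Num.sqrt z) r0 zE => r r0 zE.
  rewrite -/u' -/v' zE; field; by rewrite gt_eqF.
exists (om 1) => z z0.
have -> : om 1 = om z by apply: is_derive0_cst_pos.
rewrite /om expRN; field.
by rewrite !gt_eqF ?expR_gt0 ?sqrtr_gt0.
Qed.

End kummer_uniqueness.

(** * Identification of the Kummer function *)

Section kummer_function.
Context {R : realType}.

(** The factor [2 ^ (q - 1)] normalises the function at infinity; this way of writing it covers
    [q = 0]. *)
Definition kummer_igauss (q : nat) (z : R) : R := 2 ^+ q / 2 * kummer_sol q z.

Lemma kummer_igauss_gt0 q (z : R) : 0 < z -> 0 < kummer_igauss q z.
Proof. by move=> z0; rewrite mulr_gt0 ?kummer_sol_gt0 ?divr_gt0 ?exprn_gt0. Qed.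

Lemma kummer_igauss_equiv (q : nat) (s : R) : 2 * s = q%:R + 1 ->
  kummer_igauss q z / z `^ (- (s - 1)) @[z --> +oo] --> (1 : R).
Proof.
move=> sq; apply: (@eq_cvg_pinfty _ _ ((fun t : R =>
    expR (t ^+ 2) * igauss q t * (2 * t) ^+ q / (2 * t)) \o Num.sqrt) 1).
  move=> z z1; have z0 : 0 < z by exact: lt_le_trans z1.
  have r0 : 0 < Num.sqrt z by rewrite sqrtr_gt0.
  have -> : z `^ (- (s - 1)) = Num.sqrt z / Num.sqrt z ^+ q.
    rewrite -!powR12_sqrt ?(ltW z0) // -powR_mulrn ?powR_ge0 // -powRrM -powRB.
      by congr (_ `^ _); lra.
    by apply/implyP => _; rewrite gt_eqF.
  rewrite /= sqr_sqrtr ?(ltW z0) // /kummer_igauss /kummer_sol exprMn.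
  move: (Num.sqrt z) r0 => r r0; have rq : r ^+ q != 0 by rewrite expf_neq0 ?gt_eqF.
  by move: (r ^+ q) rq (2 ^+ q) => p p0 c; field; rewrite p0 gt_eqF.
by apply: cvg_comp cvg_sqrt_pinfty (cvg_igauss_ratio q).
Qed.

(** By [is_derive_kummer_sol] the two derivatives involve only the levels [q + 1] and [q + 2], and
    Kummer's equation becomes [igauss_rec]. *)
Lemma is_kummerU_igauss (q : nat) (s : R) : 2 * s = q%:R + 1 ->
  is_kummerU (s - 1) 2^-1 (kummer_igauss q).
Proof.
move=> sq; split; last exact: kummer_igauss_equiv.
move=> z z0; have r0 : 0 < Num.sqrt z by rewrite sqrtr_gt0.
pose c : R := 2 ^+ q / 2.
pose U' z := c * ((1 - q%:R) * (kummer_sol q.+1 z / Num.sqrt z)).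
have d1 (y : R) : 0 < y -> is_derive y 1 (kummer_igauss q) (U' y).
  move=> y0; apply: is_derive_ext (is_derive_scale c (is_derive_kummer_sol q y0))
    (fun=> erefl _) _.
  by rewrite /U' -(mulrA (1 - _)).
have d2 : is_derive z 1 U' (c * ((1 - q%:R) *
   (- q%:R * kummer_sol q.+2 z / z - kummer_sol q.+1 z / (2 * Num.sqrt z * z)))).
  have dV := is_derive_inv (is_derive1_sqrt z0) (lt0r_neq0 r0).
  apply: is_derive_ext (is_derive_scale c (is_derive_scale (1 - q%:R)
    (is_derive_mul (is_derive_kummer_sol q.+1 z0) dV))) (fun=> erefl _) _.
  congr (c * (_ * _)); rewrite -natr1.
  have zE : z = Num.sqrt z ^+ 2 by rewrite sqr_sqrtr ?ltW.
  move: (kummer_sol q.+2 z) (kummer_sol q.+1 z) => h2 h1.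
  by move: (Num.sqrt z) r0 zE => r r0 ->; field; rewrite gt_eqF.
have {}d2 : is_derive z 1 (derive1 (kummer_igauss q)) (c * ((1 - q%:R) *
   (- q%:R * kummer_sol q.+2 z / z - kummer_sol q.+1 z / (2 * Num.sqrt z * z)))).
  apply: near_eq_is_derive d2; near=> y.
  by apply/esym/is_derive_derive1/d1; near: y; exact: lt_nbhsr.
have d1z := d1 z z0.
split; [by case: d1z|by case: d2|].
rewrite (is_derive_derive1 d2) (is_derive_derive1 d1z) /kummer_igauss /U' /kummer_sol.
have -> : igauss q (Num.sqrt z) = 2 * q%:R * igauss q.+2 (Num.sqrt z)
    + 2 * Num.sqrt z * igauss q.+1 (Num.sqrt z) by rewrite igauss_rec subrK.
have -> : s - 1 = (q%:R - 1) / 2 by lra.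
rewrite -/c; have zE : z = Num.sqrt z ^+ 2 by rewrite sqr_sqrtr ?ltW.
move: (expR z) => e; move: (Num.sqrt z) r0 zE => r r0 ->; field.
by rewrite gt_eqF.
Unshelve. all: by end_near. Qed.

(** The quotient of the solutions tends to 1, and its derivative is the Wronskian over [U ^ 2].
    Convergence forces the Wronskian to be 0, so the quotient is constant. *)
Lemma kummer_igauss_unique (q : nat) (s : R) (V : R -> R) : 2 * s = q%:R + 1 ->
  is_kummerU (s - 1) 2^-1 V -> forall z, 0 < z -> V z = kummer_igauss q z.
Proof.
move=> sq VU; set U := kummer_igauss q; have UU := is_kummerU_igauss sq.
have [c cE] := kummer_wronskian UU VU.
have dquot (z : R) : 0 < z -> is_derive z 1 (fun z => V z / U z)
    (c * (expR z / (Num.sqrt z * U z ^+ 2))).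
  move=> z0; have [dU _ _] := UU.1 z z0; have [dV _ _] := VU.1 z z0.
  have r0 : 0 < Num.sqrt z by rewrite sqrtr_gt0.
  have U0 := kummer_igauss_gt0 q z0.
  have := is_derive_mul (derivable_is_derive dV)
    (is_derive_inv (derivable_is_derive dU) (lt0r_neq0 U0)).
  move/is_derive_ext; apply => //.
  transitivity ((U z * derive1 V z - V z * derive1 U z) / U z ^+ 2).
    by rewrite /U; field; rewrite gt_eqF.
  by rewrite cE // /U; field; rewrite !gt_eqF.
have quot1 : V z / U z @[z --> +oo] --> (1 : R).
  apply: (@eq_cvg_pinfty _ _
    (fun z => V z / z `^ (- (s - 1)) / (U z / z `^ (- (s - 1)))) 1).
    move=> z z1; have z0 : 0 < z by exact: lt_le_trans z1.
    rewrite /U; field; rewrite (gt_eqF (powR_gt0 _ z0)).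
    by rewrite (gt_eqF (kummer_igauss_gt0 q z0)).
  rewrite -[X in _ --> X]divr1; apply: cvgM; first exact: VU.2.
  by apply: cvgV; rewrite ?oner_neq0 //; exact: UU.2.
have c0 : c = 0.
  apply/eqP; rewrite -normr_le0 leNgt; apply/negP => c_gt0.
  (* A lower bound for the absolute derivative of the quotient on [[1, +oo[], from
     [U x <= 2 ^ q * sqrt x], [sqrt x <= x] and [expR x >= x ^ 2 / 2]. *)
  pose del := `|c| / (2 * (2 ^+ q) ^+ 2).
  have del0 : 0 < del by rewrite divr_gt0 // mulr_gt0 ?exprn_gt0.
  have quot_incr (z : R) : 1 <= z ->
      del <= `|V (z + 1) / U (z + 1) - V z / U z|.
    move=> z1; have [||x /andP[zx xz] ->] := @MVT_pointwise _ (fun z => V z / U z)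
      (fun z => c * (expR z / (Num.sqrt z * U z ^+ 2))) z (z + 1); first by lra.
      by move=> x /andP[zx _]; apply: dquot; lra.
    have x0 : 0 < x by lra.
    have U0 := kummer_igauss_gt0 q x0.
    have r0 : 0 < Num.sqrt x by rewrite sqrtr_gt0.
    rewrite [z + 1]addrC addrK mulr1 normrM ler_wpM2l //.
    have rU0 : 0 < Num.sqrt x * U x ^+ 2 by rewrite mulr_gt0 // exprn_gt0.
    rewrite ger0_norm; last by rewrite divr_ge0 ?expR_ge0 // ltW.
    have x1 : 1 <= x by exact: le_trans zx.
    have p0 : 0 < (2 : R) ^+ q by rewrite exprn_gt0.
    have p2 : 0 < 2 * ((2 : R) ^+ q) ^+ 2 by rewrite mulr_gt0 // exprn_gt0.
    rewrite ler_pdivlMr // ler_pdivrMl //.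
    have Ule : U x <= 2 ^+ q * Num.sqrt x.
      rewrite /U /kummer_igauss -mulrA ler_pM2l // ler_pdivrMl //.
      exact: kummer_sol_le.
    have U2le : U x ^+ 2 <= (2 ^+ q) ^+ 2 * x.
      rewrite -[X in _ * X](sqr_sqrtr (ltW x0)) -exprMn ler_pXn2r //.
        by rewrite nnegrE ltW.
      by rewrite nnegrE mulr_ge0 ?ltW.
    have rle : Num.sqrt x <= x.
      rewrite -[leRHS](sqr_sqrtr (ltW x0)) expr2 ler_peMr ?(ltW r0) //.
      by rewrite -sqrtr1 ler_wsqrtr.
    have ex : x * x / 2 <= expR x.
      by have := expR_ge1Dxn 1 (ltW x0); rewrite expr2 (_ : 2`! = 2)%N //; lra.
    apply: le_trans (_ : x * ((2 ^+ q) ^+ 2 * x) <= _).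
      by apply: ler_pM; rewrite ?sqr_ge0 ?(ltW r0).
    have -> : x * ((2 ^+ q) ^+ 2 * x) = 2 * (2 ^+ q) ^+ 2 * (x * x / 2).
      by move: (2 ^+ q) => p; field.
    by rewrite ler_wpM2l // mulr_ge0 ?sqr_ge0.
  have del2 : 0 < del / 2 by rewrite divr_gt0.
  move/cvgrPdist_lt/(_ _ del2): (quot1) => [M [_ HM]].
  have m1 : 1 <= Num.max 1 M + 1.
    have : 1 <= Num.max 1 M by rewrite le_max lexx.
    lra.
  have mM : M < Num.max 1 M + 1.
    have : M <= Num.max 1 M by rewrite le_max lexx orbT.
    lra.
  have := quot_incr _ m1; move: (Num.max _ _ + 1) mM => z mM.
  have mM1 : M < z + 1 by lra.
  have := HM z mM; have := HM (z + 1) mM1 => /=.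
  move: (V z / U z) (V (z + 1) / U (z + 1)) => u v h1 h2 h3.
  have tri : `|v - u| <= `|1 - v| + `|1 - u|.
    by rewrite [X in _ <= X + _]distrC; exact: ler_distD.
  by clearbody del; lra.
move=> z z0; suff : V z / U z = 1.
  by move/(congr1 ( *%R^~ (U z))); rewrite mulfVK ?mul1r ?gt_eqF ?kummer_igauss_gt0.
apply: (cvg_unique _ _ quot1) => //.
apply: (@eq_cvg_pinfty _ _ (fun=> V z / U z) 1); last exact: cvg_cst.
move=> y y1; apply: (@is_derive0_cst_pos _ (fun z => V z / U z)) => //; last by lra.
move=> x x0; apply: is_derive_ext (dquot x x0) (fun=> erefl _) _.
by rewrite c0 mul0r.
Qed.

End kummer_function.

(** * The limit law *)

Section gamma_half_integer.
Context {R : realType}.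
Local Notation mu := (@lebesgue_measure R).

(** The integrand may be unbounded at 0, as in the Gamma integral. The half-line is exhausted by the
    sets [[1 / (n + 1), +oo[], and monotone convergence applies. *)
Lemma ge0_integral_0y (f F : R -> R) (l : R) :
  (forall x, 0 < x -> 0 <= f x) -> (forall x, 0 < x -> {for x, continuous f}) ->
  (forall x : R, 0 < x -> is_derive x 1 F (f x)) ->
  F x @[x --> 0^'+] --> F 0 -> F x @[x --> +oo] --> l ->
  (\int[mu]_(x in `]0%R, +oo[) (f x)%:E = (l - F 0)%:E)%E.
Proof.
move=> f0 cf dF F0 Fl.
pose S n : set R := `[n.+1%:R^-1, +oo[%classic.
have bigS : \bigcup_n S n = `]0%R, +oo[%classic.
  apply/seteqP; split => [x [n _]|x]; rewrite /S /= !in_itv /= !andbT.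
    by apply: lt_le_trans; rewrite invr_gt0.
  move=> x0; exists (Num.truncn x^-1) => //=; rewrite in_itv /= andbT.
  rewrite -[leRHS]invrK lef_pV2 ?posrE ?invr_gt0 //.
  by rewrite ltW // truncnS_gt.
have Sgt0 n x : S n x -> 0 < x.
  by rewrite /S /= in_itv /= andbT; apply: lt_le_trans; rewrite invr_gt0.
have ES n : (\int[mu]_(x in S n) (f x)%:E = (l - F n.+1%:R^-1)%:E)%E.
  have n0 : 0 < n.+1%:R^-1 :> R by rewrite invr_gt0.
  rewrite EFinB; apply: ge0_continuous_FTC2y => //.
  - by move=> x nx; apply/f0/(lt_le_trans n0).
  - apply: continuous_in_subspaceT => x; rewrite inE => /Sgt0; exact: cf.
  - by move=> x nx; case: (dF x (lt_trans n0 nx)).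
  - apply: cvg_at_right_filter; apply: is_derive_continuous; exact: dF.
  - move=> x; rewrite in_itv /= andbT => nx.
    by apply/is_derive_derive1/dF/(lt_trans n0).
have cS : (\int[mu]_(x in S n) (f x)%:E)%E @[n --> \oo] -->
    (\int[mu]_(x in `]0%R, +oo[) (f x)%:E)%E.
  rewrite -bigS; apply: ge0_nondecreasing_set_cvg_integral.
  - apply/nondecreasing_seqP => n; rewrite subsetEset => x.
    rewrite /S /= !in_itv /= !andbT; apply: le_trans.
    by rewrite lef_pV2 ?posrE ?ltr0n // ler_nat.
  - by move=> n; exact: measurable_itv.
  - move=> n; apply/measurable_realfun.measurable_EFinP.
    apply: measurable_realfun.subspace_continuous_measurable_fun; first exact: measurable_itv.
    by apply: continuous_in_subspaceT => x; rewrite inE => /Sgt0; exact: cf.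
  - by move=> n x /Sgt0 x0; rewrite lee_fin f0.
apply: (cvg_unique _ cS) => //.
have -> : (fun n => \int[mu]_(x in S n) (f x)%:E)%E =
    EFin \o (fun n => l - F n.+1%:R^-1) by apply/funext => n; rewrite ES.
apply: cvg_EFin; first exact: nearW.
apply: (@cvgB _ _ _ _ _ (fun=> l)); first exact: cvg_cst.
move/cvg_at_rightP: F0; apply; split; last exact: cvg_harmonic.
by move=> n; rewrite invr_gt0.
Qed.

(** Twice the integral of [t ^ q exp (- t ^ 2)] over [[y, +oo[]; the recursion is integration by
    parts. *)
Fixpoint gauss_moment (q : nat) (y : R) : R :=
  match q with
  | 0 => 2 * igauss 2 y
  | 1 => igauss 1 y
  | q'.+2 => y ^+ q'.+1 * igauss 1 y + q'.+1%:R / 2 * gauss_moment q' y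
  end.

Lemma is_derive_exprn (x : R) n :
  is_derive x 1 (fun y => y ^+ n.+1) (n.+1%:R * x ^+ n).
Proof.
elim: n => [|n IH]; first by rewrite expr0 mulr1; exact: is_derive_id.
apply: is_derive_ext (is_derive_mul (is_derive_id x 1) IH) (fun=> esym (exprS _ _)) _.
by rewrite -[n.+2%:R]natr1 exprS; ring.
Qed.

Lemma is_derive_gauss_moment q (y : R) : -1 < y ->
  is_derive y 1 (gauss_moment q) (- 2 * y ^+ q * expR (- y ^+ 2)).
Proof.
move=> y1; elim/ltn_ind: q => -[|[|q]] IH.
- apply: is_derive_ext (is_derive_scale 2 (is_derive_igauss 1 y1)) (fun=> erefl _) _.
  by rewrite expr0 mulr1 mulrN mulNr.
- apply: is_derive_ext (is_derive_igauss 0 y1) (fun=> erefl _) _.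
  by rewrite /igauss expr1 !mulNr.
- have d := IH q (ltnW (ltnSn _)).
  apply: is_derive_ext (is_derive_add
    (is_derive_mul (is_derive_exprn y q) (is_derive_igauss 0 y1))
    (is_derive_scale (q.+1%:R / 2) d)) (fun=> erefl _) _.
  by rewrite /igauss !exprS; move: (expR _) (y ^+ q) => e p; field.
Qed.

Lemma cvg_exprn_gauss n : t ^+ n * igauss 1 t @[t --> +oo] --> (0 : R).
Proof. exact: exp_bounded_cvg0M (exp_bounded_igauss 1). Qed.

Lemma cvg_gauss_moment q : gauss_moment q t @[t --> +oo] --> (0 : R).
Proof.
elim/ltn_ind: q => -[|[|q]] IH /=.
- by rewrite -(mulr0 2); apply: cvgM; [exact: cvg_cst | exact: cvg_igauss].
- exact: cvg_igauss.
- rewrite -(addr0 0); apply: cvgD; first exact: cvg_exprn_gauss.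
  rewrite -(mulr0 (q.+1%:R / 2)); apply: cvgM; first exact: cvg_cst.
  exact/IH/ltnW/ltnSn.
Qed.

(** The substitution [t = u ^ 2], carried out on the antiderivative [- gauss_moment q (sqrt t)]. *)
Lemma Gamma_gauss_moment (q : nat) (s : R) : 2 * s = q%:R + 1 ->
  Gamma s = gauss_moment q 0.
Proof.
move=> sq; rewrite /Gamma /Rintegral.
have -> : gauss_moment q 0 = fine (0 - - gauss_moment q (Num.sqrt 0))%:E.
  by rewrite /= sqrtr0 sub0r opprK.
congr (fine _); apply: (@ge0_integral_0y _
  (fun t => - gauss_moment q (Num.sqrt t))).
- by move=> x x0; rewrite mulr_ge0 ?powR_ge0 ?expR_ge0.
- move=> x x0; apply: continuousM; first apply: is_derive_continuous.
    exact: (@is_derive1_powR _ (s - 1) x x0).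
  apply: is_derive_continuous; apply: is_derive_expR_comp; exact: is_deriveNid.
- move=> x x0; have r0 : 0 < Num.sqrt x by rewrite sqrtr_gt0.
  have d := is_derive_scale (-1) (is_derive_comp
    (is_derive_gauss_moment q (sqrtr_gtN1 x)) (is_derive1_sqrt x0)).
  apply: is_derive_ext d (fun y => mulN1r _) _.
  rewrite sqr_sqrtr ?(ltW x0) //.
  have -> : x `^ (s - 1) = Num.sqrt x ^+ q / Num.sqrt x.
    rewrite -!powR12_sqrt ?(ltW x0) // -powR_mulrn ?powR_ge0 // -powRrM -powRB.
      by congr (_ `^ _); lra.
    by apply/implyP => _; rewrite gt_eqF.
  by move: (_ ^+ q) (expR _) => p e; field; rewrite gt_eqF.
- apply: cvg_at_right_filter; apply: cvgN.
  apply: continuous_cvg; last exact: sqrt_continuous.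
  exact: is_derive_continuous (is_derive_gauss_moment q (sqrtr_gtN1 0)).
- have c0 : gauss_moment q (Num.sqrt t) @[t --> +oo] --> (0 : R).
    exact: cvg_comp cvg_sqrt_pinfty (cvg_gauss_moment q).
  suff : - gauss_moment q (Num.sqrt t) @[t --> +oo] --> - (0 : R).
    by rewrite oppr0.
  exact: cvgN.
Qed.

(** This matches the constant of [kappa] with the total mass. From [q] to [q + 2] the first factor
    is divided by [2 (q + 1)], the second multiplied by 4 and Gamma by [(q + 1) / 2]. *)
Lemma igauss0_Gamma (q : nat) (s : R) : 2 * s = q%:R + 1 ->
  igauss q.+1 0 * 2 ^+ q * Gamma s = Num.sqrt pi.
Proof.
move=> sq; rewrite (Gamma_gauss_moment sq).
elim/ltn_ind: q {s sq} => -[|[|q]] IH.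
- have -> : igauss 1 0 = 1 :> R by rewrite /igauss expr0n oppr0 expR0.
  by rewrite /= /igauss /= gauss_tail0; field.
- have -> : gauss_moment 1 0 = 1 :> R by rewrite /= /igauss expr0n oppr0 expR0.
  by rewrite /igauss /= gauss_tail0; field.
- rewrite igaussSS /= expr0n mulr0 !mul0r subr0 add0r -(IH q) ?exprS; last exact: ltnW.
  have q0 := ler0n R q; rewrite -natr1; move: (2 ^+ q) => p; field; lra.
Qed.

End gamma_half_integer.

(** * Density and distribution function of the limit law *)

Section limit_distribution.
Context {R : realType}.
Local Notation mu := (@lebesgue_measure R).

Lemma kappa_igauss (q : nat) (s x : R) : 2 * s = q%:R + 1 -> 0 < x ->
  kappa s x = igauss q (x / Num.sqrt (2 * s)) / (igauss q.+1 0 * Num.sqrt (2 * s)).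
Proof.
move=> sq x0; have s2 : 0 < 2 * s by rewrite sq ltr_wpDl.
have r2 : 0 < Num.sqrt (2 * s) by rewrite sqrtr_gt0.
have rpi : 0 < Num.sqrt pi :> R by rewrite sqrtr_gt0 pi_gt0.
have pi0 : 0 < pi :> R := pi_gt0 R.
(* Existence makes the choice in [kummerU] satisfy [is_kummerU]; uniqueness then identifies it on
   the positive axis. *)
have UE := xgetPex (cst 0) (ex_intro _ _ (is_kummerU_igauss sq)).
have z0 : 0 < x ^+ 2 / (2 * s) by rewrite divr_gt0 // exprn_gt0.
rewrite /kappa /kummerU (kummer_igauss_unique sq UE z0) /kummer_igauss /kummer_sol.
have -> : Num.sqrt (x ^+ 2 / (2 * s)) = x / Num.sqrt (2 * s).
  by rewrite sqrtrM ?sqr_ge0 // sqrtr_sqr gtr0_norm // sqrtrV // ltW.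
have I0 : 0 < igauss q.+1 0 :> R by rewrite igauss_gt0.
have -> : Num.sqrt (2 / (s * pi)) = 2 / (Num.sqrt (2 * s) * Num.sqrt pi).
  have -> : 2 / (s * pi) = (2 / (Num.sqrt (2 * s) * Num.sqrt pi)) ^+ 2.
    rewrite expr_div_n exprMn !sqr_sqrtr ?(ltW s2) ?(ltW pi0) //.
    have s0 : 0 < s by lra.
    by move: pi pi0 => p p0; field; rewrite (gt_eqF p0) (gt_eqF s0).
  by rewrite sqrtr_sqr ger0_norm // divr_ge0 // mulr_ge0 ltW.
have GE := igauss0_Gamma sq.
have e0 : expR (- x ^+ 2 / (2 * s)) * expR (x ^+ 2 / (2 * s)) = 1.
  by rewrite mulNr -expRD addNr expR0.
have -> : Gamma s = Num.sqrt pi / (igauss q.+1 0 * 2 ^+ q).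
  by rewrite -GE [X in X / _]mulrC mulfK // mulf_neq0 ?expf_neq0 ?gt_eqF.
have q0 : (2 : R) ^+ q != 0 by rewrite expf_neq0.
have -> : expR (x ^+ 2 / (2 * s)) = (expR (- x ^+ 2 / (2 * s)))^-1.
  by rewrite mulNr expRN invrK.
have eN0 : expR (- x ^+ 2 / (2 * s)) != 0 by rewrite gt_eqF ?expR_gt0.
move: (expR _) eN0 (2 ^+ q) q0 (igauss q _) => e eN0 p p0 i.
move: (Num.sqrt pi) rpi (igauss q.+1 0) I0 (Num.sqrt (2 * s)) r2 => rp rp0 j j0 r r0.
by field; rewrite eN0 p0 !gt_eqF.
Qed.

Lemma is_derive_igauss_lin n (c x : R) : 0 < c -> 0 <= x ->
  is_derive x 1 (fun y => igauss n.+1 (y / c)) (- igauss n (x / c) / c).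
Proof.
move=> c0 x0; have xc : -1 < c^-1 * x by rewrite mulrC; have := divr_ge0 x0 (ltW c0); lra.
have d := @is_derive_comp _ (igauss n.+1) (fun y => c^-1 * y) x _ _
  (is_derive_igauss n xc) (is_derive_scale c^-1 (is_derive_id x 1)).
apply: is_derive_ext d _ _ => [y|]; first by rewrite mulrC.
by rewrite mulr1 [c^-1 * x]mulrC.
Qed.

Lemma K_igauss (q : nat) (s x : R) : 2 * s = q%:R + 1 -> 0 <= x ->
  K s x = 1 - igauss q.+1 (x / Num.sqrt (2 * s)) / igauss q.+1 0.
Proof.
move=> sq; have s2 : 0 < 2 * s by rewrite sq ltr_wpDl.
have r2 : 0 < Num.sqrt (2 * s) by rewrite sqrtr_gt0.
have I0 : 0 < igauss q.+1 0 :> R by rewrite igauss_gt0.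
rewrite le_eqVlt => /predU1P[<-|x0].
  rewrite mul0r divff ?gt_eqF // subrr /K set_itv_ge ?bnd_simp //.
  by rewrite Rintegral_set0.
(* The continuous extension to 0 of the density, whose own value at 0 is junk. *)
pose f (t : R) := igauss q (t / Num.sqrt (2 * s)) / (igauss q.+1 0 * Num.sqrt (2 * s)).
pose F (t : R) := - igauss q.+1 (t / Num.sqrt (2 * s)) / igauss q.+1 0.
have cf : {within `[0, x], continuous f}.
  apply: continuous_in_subspaceT => t; rewrite inE /= in_itv /= => /andP[t0 _].
  have tr : -1 < t / Num.sqrt (2 * s) by have := divr_ge0 t0 (ltW r2); lra.
  rewrite /f /prop_for /continuous_at; apply: cvgM; last exact: cvg_cst.
  apply: continuous_cvg; first exact: continuous_igauss.
  by apply: cvgM; [exact: cvg_id | exact: cvg_cst].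
have fint : mu.-integrable `[0, x] (EFin \o f).
  by apply: continuous_compact_integrable => //; exact: segment_compact.
have dF (t : R) : 0 <= t -> is_derive t 1 F (f t).
  move=> t0; have := is_derive_scale (- (igauss q.+1 0)^-1)
    (is_derive_igauss_lin q r2 t0).
  move/is_derive_ext; apply => [y|]; first by rewrite /F mulNr mulrC mulNr.
  by rewrite /f; field; rewrite !gt_eqF.
have -> : K s x = \int[mu]_(t in `]0, x]) f t.
  apply: eq_Rintegral => t; rewrite inE /= in_itv /= => /andP[t0 _].
  by rewrite (kappa_igauss sq).
rewrite Rintegral_itv_obnd_cbnd; last first.
  apply: integrableS fint => //.
  by apply: subset_itv; rewrite bnd_simp.
rewrite /Rintegral (@continuous_FTC2 _ f F) //.
- by rewrite -EFinB /= /F mul0r; field; rewrite gt_eqF.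
- split.
  + by move=> t; rewrite in_itv /= => /andP[/ltW t0 _]; case: (dF t t0).
  + by apply: cvg_at_right_filter; apply: is_derive_continuous; exact: dF.
  + by apply: cvg_at_left_filter; apply: is_derive_continuous; apply: dF; exact: ltW.
- by move=> t; rewrite in_itv /= => /andP[/ltW t0 _]; exact/is_derive_derive1/dF.
Qed.

Lemma K_le0 (s x : R) : x <= 0 -> K s x = 0.
Proof.
by move=> x0; rewrite /K set_itv_ge ?Rintegral_set0 // bnd_simp -leNgt.
Qed.

End limit_distribution.

(** * Rate of convergence *)

Section rate.
Context {R : realType}.

(** The product of [exp (- i / (2 k))] over [i < j], to be compared with [ballot] factor by
    factor. *)
Definition gauss_step (k j : nat) : R :=
  expR (- (j%:R * (j%:R - 1) / (4 * k%:R))).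

Lemma gauss_stepS k j : (0 < k)%N ->
  gauss_step k j.+1 = gauss_step k j * expR (- (j%:R / (2 * k%:R))).
Proof.
move=> k0; have k1 : 0 < k%:R :> R by rewrite ltr0n.
rewrite /gauss_step -expRD -natr1; congr expR; field.
by rewrite gt_eqF.
Qed.

(** The factor is [(1 - 2 x) / (1 - x)], which agrees with [exp (- x)] to first order. Here
    [x <= 1/2], so the constant 5 leaves room for the cubic term. *)
Lemma ballot_factor k j : (0 < k)%N -> (j <= k)%N ->
  let x : R := j%:R / (2 * k%:R) in
  let rho := 2 * (k%:R - j%:R) / (2 * k%:R - j%:R) in
  [/\ rho <= expR (- x), expR (- x) * (1 - 5 * x ^+ 2) <= rho & 0 <= rho].
Proof.
move=> k0 jk; have k1 : 0 < k%:R :> R by rewrite ltr0n.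
have j0 : 0 <= j%:R :> R by [].
have jk' : j%:R <= k%:R :> R by rewrite ler_nat.
move=> x rho.
have x0 : 0 <= x by rewrite divr_ge0 // mulr_ge0 // ltW.
have x2 : x <= 2^-1 by rewrite ler_pdivrMr ?mulr_gt0 //; lra.
have jE : j%:R = 2 * k%:R * x by rewrite /x; field; rewrite gt_eqF.
have rhoE : rho = (1 - 2 * x) / (1 - x).
  rewrite /rho jE; clearbody x; field.
  by apply/andP; split; rewrite gt_eqF //; nra.
clearbody x rho; rewrite {}rhoE {rho jE}.
have x1 : 0 < 1 - x by lra.
have e0 := expR_gt0 (- x); have e1 := expR_ge1Dx (- x).
have e2 : expR (- x) * (1 + x) <= 1.
  by rewrite expRN mulrC ler_pdivrMr ?expR_gt0 // mul1r expR_ge1Dx.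
split.
- by apply: le_trans e1; rewrite ler_pdivrMr //; nra.
- rewrite ler_pdivlMr //.
  have [h|h] := leP 0 (1 - 5 * x ^+ 2); last by nra.
  have -> : expR (- x) * (1 - 5 * x ^+ 2) * (1 - x)
     = expR (- x) * ((1 - 5 * x ^+ 2) * (1 - x)) by ring.
  apply: le_trans (_ : expR (- x) * ((1 + x) * (1 - 2 * x)) <= _).
    by rewrite ler_pM2l //; nra.
  by rewrite mulrA ler_piMl //; lra.
- by rewrite divr_ge0 //; lra.
Qed.

Lemma ballot_le_gauss k j : (0 < k)%N -> ballot k j <= gauss_step k j.
Proof.
move=> k0; elim: j => [|j IH].
  by rewrite ballot0 /gauss_step !mul0r oppr0 expR0.
have [jk|kj] := leqP j k; last first.
  by rewrite ballot_gt ?(leqW kj) // expR_ge0.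
have [h1 _ h3] := ballot_factor k0 jk.
rewrite ballotS gauss_stepS //; apply: ler_pM => //.
exact: (@itail_ge0 _ 0).
Qed.

(** The relative losses add up: [5 x ^ 2 = 5 j ^ 2 / (4 k ^ 2)] is at most the increment of
    [2 j ^ 3 / k ^ 2]. Where the left side is not positive the claim is trivial. *)
Lemma ballot_ge_gauss k j : (0 < k)%N ->
  gauss_step k j * (1 - 2 * j%:R ^+ 3 / k%:R ^+ 2) <= ballot k j.
Proof.
move=> k0; have k1 : 1 <= k%:R :> R by rewrite ler1n.
have neg (i : nat) : 1 - 2 * i%:R ^+ 3 / k%:R ^+ 2 <= 0 :> R ->
    gauss_step k i * (1 - 2 * i%:R ^+ 3 / k%:R ^+ 2) <= ballot k i.
  move=> i0; apply: le_trans (_ : 0 <= _); last exact: (@itail_ge0 _ 0).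
  by rewrite mulr_ge0_le0 // expR_ge0.
elim: j => [|j IH].
  by rewrite ballot0 /gauss_step !mul0r oppr0 expR0 expr0n /= mulr0 mul0r subr0 mulr1.
have k2 : 0 < k%:R ^+ 2 :> R by rewrite exprn_gt0 //; lra.
have [jk|kj] := leqP j k; last first.
  apply: neg; rewrite subr_le0 ler_pdivlMr // mul1r.
  have : k%:R <= j.+1%:R :> R by rewrite ler_nat ltnW // ltnW.
  move: (j.+1%:R : R) => y ky; rewrite exprS.
  have : k%:R ^+ 2 <= y ^+ 2 by rewrite ler_pXn2r ?nnegrE //; lra.
  by move: (y ^+ 2) (k%:R ^+ 2) k2 => a c c0 ca; nra.
have [P0|P0] := leP (1 - 2 * j%:R ^+ 3 / k%:R ^+ 2 : R) 0.
  apply: neg; apply: le_trans P0; rewrite lerD2l lerN2.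
  rewrite ler_pM2r ?invr_gt0 // ler_pM2l // ler_pXn2r ?nnegrE // ler_nat //.
have [_ h2 h3] := ballot_factor k0 jk.
rewrite ballotS gauss_stepS //.
apply: le_trans (ler_wpM2r h3 IH).
rewrite -[leLHS]mulrA -[leRHS]mulrA ler_wpM2l ?expR_ge0 //.
apply: le_trans (ler_wpM2l (ltW P0) h2).
rewrite [leRHS]mulrCA ler_wpM2l ?expR_ge0 // -(natr1 j).
have j0 : 0 <= j%:R :> R by [].
set x := j%:R / _; set P := 1 - 2 * j%:R ^+ 3 / _ in P0 *.
have P1 : P <= 1 by rewrite /P gerBl divr_ge0 // ?mulr_ge0 ?exprn_ge0 // ltW.
have xE : 5 * x ^+ 2 = 5 / 4 * (j%:R ^+ 2 / k%:R ^+ 2).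
  by rewrite /x; field; rewrite gt_eqF //; lra.
have -> : 1 - 2 * (j%:R + 1) ^+ 3 / k%:R ^+ 2 =
   P - (6 * j%:R ^+ 2 + 6 * j%:R + 2) / k%:R ^+ 2.
  by rewrite /P; field; rewrite gt_eqF //; lra.
have : 5 * x ^+ 2 <= (6 * j%:R ^+ 2 + 6 * j%:R + 2) / k%:R ^+ 2.
  by rewrite xE mulrA ler_pM2r ?invr_gt0 //; nra.
have := sqr_ge0 x; move: (_ / k%:R ^+ 2) (x ^+ 2) P P0 P1 => a y P P0 P1 y0 ya.
by nra.
Qed.

Definition scale (k : nat) : R := 2 * Num.sqrt k%:R.

Lemma scale_ge1 k : (0 < k)%N -> 1 <= scale k.
Proof.
move=> k0; have : 1 <= Num.sqrt k%:R :> R.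
  by rewrite -[leLHS]sqrtr1; apply: ler_wsqrtr; rewrite ler1n.
by rewrite /scale; lra.
Qed.

Lemma scale_sqr k : scale k ^+ 2 = 4 * k%:R.
Proof. by rewrite exprMn sqr_sqrtr //; ring. Qed.

Lemma ballot_approx : exists2 C : R, 0 < C & forall k j, (0 < k)%N ->
  `|ballot k j - igauss 1 (j%:R / scale k)| <= C / scale k * expR (- (j%:R / scale k)).
Proof.
(* With [t = j / scale k], the error is at most [gauss_step k j * (32 t ^ 3 + t) / scale k]. Here
   [32 t ^ 3 + t <= (32 * 6 + 1) exp t], and the 4 comes from [- t ^ 2 + 3 t <= 4]. *)
exists (193 * expR 4); first by rewrite mulr_gt0 ?expR_gt0.
move=> k j k0; have s1 := scale_ge1 k0; have s2 := scale_sqr k.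
have k1 : 1 <= k%:R :> R by rewrite ler1n.
move: (scale k) s1 s2 => s s1 s2; set t := j%:R / s.
have s0 : 0 < s by lra.
have t0 : 0 <= t by rewrite divr_ge0 // ltW.
have jE : j%:R = t * s by rewrite /t mulfVK // gt_eqF.
have u1 : s^-1 <= 1 by rewrite invf_le1.
have kE : k%:R = s ^+ 2 / 4 by rewrite s2; field.
have stepE : gauss_step k j = expR (- t ^+ 2 + t / s).
  by rewrite /gauss_step kE jE; congr expR; field; rewrite gt_eqF.
have x3E : 2 * j%:R ^+ 3 / k%:R ^+ 2 = 32 * t ^+ 3 / s.
  by rewrite kE jE; field; rewrite gt_eqF.
have le1 := ballot_le_gauss j k0.
have := ballot_ge_gauss j k0; rewrite x3E => le2.
have g0 : 0 < gauss_step k j by exact: expR_gt0.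
have igE : igauss 1 t = gauss_step k j * expR (- (t / s)).
  by rewrite stepE -expRD /igauss addrK.
have e1 := expR_ge1Dx (- (t / s)).
have e2 : expR (- (t / s)) <= 1.
  by rewrite -expR0 ler_expR oppr_le0 divr_ge0 // ltW.
have bound : `|ballot k j - igauss 1 t| <= gauss_step k j * (32 * t ^+ 3 + t) / s.
  have h1 : 0 <= 32 * t ^+ 3 / s.
    by apply: divr_ge0; [apply: mulr_ge0 => //; exact: exprn_ge0 | exact: ltW].
  have -> : gauss_step k j * (32 * t ^+ 3 + t) / s =
    gauss_step k j * (32 * t ^+ 3 / s) + gauss_step k j * (t / s) by ring.
  have h2 : 0 <= t / s by rewrite divr_ge0 // ltW.
  rewrite igE; move: (32 * t ^+ 3 / s) (t / s) (expR _) h1 h2 e1 e2 le2 => a c e.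
  move: (gauss_step k j) (ballot k j) g0 le1 => g y g0 le1 a0 c0 e1 e2 le2.
  have p1 : g * e <= g by rewrite ler_piMr // ltW.
  have p2 : g * (1 - c) <= g * e by rewrite ler_pM2l // addrC.
  have p3 := mulr_ge0 (ltW g0) a0; have p4 := mulr_ge0 (ltW g0) c0.
  by rewrite ler_norml; apply/andP; split; lra.
apply: le_trans bound _; rewrite [leRHS]mulrAC ler_pM2r ?invr_gt0 // stepE.
have texp : t ^+ 3 <= 6 * expR t.
  by have := expR_ge1Dxn 2 t0; rewrite (_ : 3`! = 6)%N //; lra.
have texp1 : t <= expR t by have := expR_ge1Dx t; lra.
apply: le_trans (_ : expR (- t ^+ 2 + t) * (193 * expR t) <= _).
  apply: ler_pM; [exact: expR_ge0 | | | lra].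
    by apply: addr_ge0 => //; apply: mulr_ge0 => //; exact: exprn_ge0.
  by rewrite ler_expR lerD2l ler_piMr.
rewrite mulrCA -[leRHS]mulrA ler_pM2l // -!expRD ler_expR.
by have := sqr_ge0 (t - 3 / 2); lra.
Qed.

Lemma igauss_nincr n (x y : R) : 0 <= x -> x <= y ->
  igauss n.+1 y <= igauss n.+1 x.
Proof.
move=> x0 xy; have [|c /andP[xc _] E] :=
    @MVT_pointwise _ (igauss n.+1) (fun t => - igauss n t) x y xy.
  by move=> z /andP[xz _]; apply: is_derive_igauss; lra.
rewrite -subr_le0 E mulNr oppr_le0 mulr_ge0 ?subr_ge0 //.
by rewrite igauss_ge0 // (le_trans x0).
Qed.

(* Summed over a grid of step [u], this says that a tail sum and the tail integral
   differ by at most the first term. *)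
Lemma igauss_diff n (x u : R) : 0 <= x -> 0 <= u ->
  u * igauss n.+1 (x + u) <= igauss n.+2 x - igauss n.+2 (x + u) <= u * igauss n.+1 x.
Proof.
move=> x0 u0; have xu : x <= x + u by rewrite lerDl.
have [|c /andP[xc cu] E] :=
    @MVT_pointwise _ (igauss n.+2) (fun t => - igauss n.+1 t) x (x + u) xu.
  by move=> z /andP[xz _]; apply: is_derive_igauss; lra.
have -> : igauss n.+2 x - igauss n.+2 (x + u) = u * igauss n.+1 c.
  by rewrite -opprB E; ring.
by rewrite !ler_wpM2l // igauss_nincr // (le_trans x0).
Qed.

(** Induction on [q]. Summing the error of level [q] over a grid of step [1 / scale k] costs one
    factor [scale k], thanks to the exponential decay kept in the bound. *)
Lemma itail_approx q : exists2 C : R, 0 < C & forall k j, (0 < k)%N ->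
  `|itail q k j - scale k ^+ q * igauss q.+1 (j%:R / scale k)|
  <= C * (scale k ^+ q / scale k) * expR (- (j%:R / scale k)).
Proof.
elim: q => [|q [C C0 IH]].
  have [C C0 HC] := ballot_approx; exists C => // k j k0.
  by rewrite itail0 expr0 mul1r mul1r; exact: HC.
have [B B0 HB] := @igauss_bound R q.+1.
exists (2 * C + B); first by lra.
move=> k j k0; have s1 := scale_ge1 k0; have s2 := scale_sqr k.
have {}IH := IH k ^~ k0.
move: (scale k) s1 s2 IH => s s1 s2 IH.
have s0 : 0 < s by lra.
have sq0 : 0 < s ^+ q by rewrite exprn_gt0.
pose t (j : nat) : R := j%:R / s.
have t0 i : 0 <= t i by rewrite divr_ge0 // ltW.
have tS i : t i.+1 = t i + s^-1 by rewrite /t -natr1 mulrDl mul1r.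
pose D i := itail q.+1 k i - s ^+ q.+1 * igauss q.+2 (t i).
(* A majorant whose decrements dominate those of [D]: the first term absorbs the summed errors of
   level [q], the second the comparison of sum and integral. *)
pose M i := 2 * C * s ^+ q * expR (- t i) + s ^+ q * igauss q.+1 (t i).
have u0 : 0 < s^-1 by rewrite invr_gt0.
have u1 : s^-1 <= 1 by rewrite invf_le1.
have exp_diff i : expR (- t i) / s <= 2 * (expR (- t i) - expR (- t i.+1)).
  rewrite tS opprD expRD; have e0 := expR_gt0 (- t i).
  have e1 : expR (- s^-1) * (1 + s^-1) <= 1.
    by rewrite expRN mulrC ler_pdivrMr ?expR_gt0 // mul1r expR_ge1Dx.
  have e2 : s^-1 <= 2 * (1 - expR (- s^-1)) by have := expR_gt0 (- s^-1); nra.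
  by have := ler_wpM2l (ltW e0) e2; lra.
have step i : `|D i - D i.+1| <= M i - M i.+1.
  have -> : D i - D i.+1 = (itail q k i - s ^+ q * igauss q.+1 (t i))
    + (s ^+ q * igauss q.+1 (t i)
       - s ^+ q.+1 * (igauss q.+2 (t i) - igauss q.+2 (t i.+1))).
    by rewrite /D (itailS q k i); ring.
  apply: le_trans (ler_normD _ _) _.
  have -> : M i - M i.+1 = C * s ^+ q * (2 * (expR (- t i) - expR (- t i.+1)))
    + s ^+ q * (igauss q.+1 (t i) - igauss q.+1 (t i.+1)) by rewrite /M; ring.
  apply: lerD.
    apply: le_trans (IH i) _; rewrite -/(t i) mulrA -[leLHS]mulrA ler_pM2l.
      by rewrite mulrC.
    by rewrite mulr_gt0.
  have /andP[d1 d2] := igauss_diff q (t0 i) (ltW u0).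
  rewrite tS (exprS s q).
  have -> : s ^+ q * igauss q.+1 (t i) -
      s * s ^+ q * (igauss q.+2 (t i) - igauss q.+2 (t i + s^-1)) =
    s ^+ q * (igauss q.+1 (t i) - s * (igauss q.+2 (t i) - igauss q.+2 (t i + s^-1))).
    by ring.
  rewrite normrM gtr0_norm // ler_pM2l //.
  have d1' := ler_wpM2l (ltW s0) d1; have d2' := ler_wpM2l (ltW s0) d2.
  rewrite mulrA divff ?gt_eqF // mul1r in d1'.
  rewrite [leRHS]mulrA divff ?gt_eqF // mul1r in d2'.
  by rewrite ger0_norm; lra.
(* Descending induction from [2 k]. From there on the tail sum is 0 and [s <= 2 * t i], so that
   [igauss_rec_ge] absorbs one factor [s]. *)
have DM m i : (2 * k <= i + m)%N -> `|D i| <= M i.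
  elim: m i => [|m IHm] i im.
    rewrite addn0 in im.
    have ki : (k < i)%N by apply: leq_trans im; rewrite mul2n -addnn -addn1 leq_add2l.
    rewrite /D itail_gt // sub0r normrN ger0_norm; last first.
      by rewrite mulr_ge0 ?igauss_ge0 // exprn_ge0 // ltW.
    have ts : s <= 2 * t i.
      rewrite /t mulrA ler_pdivlMr // -expr2 s2.
      have : (2 * k)%:R <= i%:R :> R by rewrite ler_nat.
      by rewrite natrM; lra.
    have h1 := igauss_rec_ge q.+1 (t0 i).
    have h2 := igauss_ge0 q.+2 (t0 i).
    have h3 : s * igauss q.+2 (t i) <= igauss q.+1 (t i).
      by apply: le_trans h1; rewrite ler_wpM2r.
    have -> : s ^+ q.+1 * igauss q.+2 (t i) = s ^+ q * (s * igauss q.+2 (t i)).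
      by rewrite exprS; ring.
    apply: le_trans (ler_wpM2l (ltW sq0) h3) _.
    by rewrite /M lerDr !mulr_ge0 ?expR_ge0 // ltW.
  have /IHm hi : (2 * k <= i.+1 + m)%N by rewrite addSnnS.
  have -> : D i = D i - D i.+1 + D i.+1 by rewrite subrK.
  apply: le_trans (ler_normD _ _) _.
  by have := step i; lra.
apply: le_trans (DM (2 * k)%N j (leq_addl _ _)) _.
have -> : s ^+ q.+1 / s = s ^+ q by rewrite exprS mulrAC divff ?mul1r // gt_eqF.
have := ler_wpM2l (ltW sq0) (HB (t j) (t0 j)).
by rewrite -/(t j) /M; lra.
Qed.

Lemma surv_approx q : exists2 C : R, 0 < C & forall k j, (0 < k)%N ->
  `|surv q k j - igauss q.+1 (j%:R / scale k) / igauss q.+1 0| <= C / scale k.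
Proof.
have [C C0 HC] := itail_approx q.
have I0 : 0 < igauss q.+1 0 :> R by exact: igauss_gt0.
exists (2 * C / igauss q.+1 0); first by rewrite divr_gt0 // mulr_gt0.
move=> k j k0; have s1 := scale_ge1 k0.
have s0 : 0 < scale k by lra.
have sq0 : 0 < scale k ^+ q by rewrite exprn_gt0.
have A0 : 0 < itail q k 0 :> R by exact: itail_gt0.
have b0 := HC k 0 k0; have bj := HC k j k0.
rewrite mul0r oppr0 expR0 mulr1 in b0.
have {}bj : `|itail q k j - scale k ^+ q * igauss q.+1 (j%:R / scale k)|
    <= C * (scale k ^+ q / scale k).
  have c0 : 0 <= C * (scale k ^+ q / scale k).
    by apply: mulr_ge0; [exact: ltW | apply: divr_ge0; exact: ltW].
  apply: le_trans bj _; rewrite ler_piMr // -[leRHS]expR0 ler_expR oppr_le0.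
  by apply: divr_ge0 => //; exact: ltW.
have S1 := @surv_le1 R q k j; have S0 := @surv_ge0 R q k j.
have AE : itail q k j = surv q k j * itail q k 0 :> R by rewrite divfK // gt_eqF.
rewrite {}AE in bj; move: (igauss q.+1 _) (igauss q.+1 0) I0 b0 bj => I J J0 b0 bj.
move: (surv q k j) (itail q k 0) A0 S0 S1 b0 bj => x A A0 x0 x1 b0 bj.
move: (scale k ^+ q) sq0 b0 bj => v v0; move: (scale k) s0 {s1} => s s0 b0 bj.
(* Since [0 <= x <= 1], the errors of numerator and denominator simply add up over the explicit
   denominator [v * J]. *)
have -> : x - I / J = (x * - (A - v * J) + (x * A - v * I)) / (v * J).
  by field; rewrite !gt_eqF.
rewrite normrM normfV (gtr0_norm (mulr_gt0 v0 J0)) ler_pdivrMr ?mulr_gt0 //.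
have -> : 2 * C / J / s * (v * J) = C * (v / s) + C * (v / s).
  by field; rewrite !gt_eqF.
apply: (le_trans (ler_normD _ _)); apply: (lerD _ bj).
by rewrite normrM normrN (ger0_norm x0); apply: le_trans b0; rewrite ler_piMl.
Qed.

End rate.

(** * Distance between the normalised urn and the limit law *)

Section urn_limit.
Context {R : realType}.

Definition urn_sqr q k : R := urn_expect q k (fun x => x%:R ^+ 2).

Definition urn_norm q k : R := Num.sqrt (urn_sqr q k).

Definition urn_cdf q k (x : R) : R :=
  urn_expect q k (fun d => (d%:R / urn_norm q k <= x)%R%:R).

(** The state is at least 1, so its square lies between [x (x + 1) / 2] and [x (x + 1)], whose mean
    is known. *)
Lemma urn_sqr_bounds q k : [/\ 1 + 2 * k%:R / (1 + q%:R) <= urn_sqr q k :> R,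
  urn_sqr q k <= 2 + 4 * k%:R / (1 + q%:R) :> R &
  urn_expect q k (fun x => x%:R) = 2 + 4 * k%:R / (1 + q%:R) - urn_sqr q k :> R].
Proof.
have q0 := ler0n R q.
have E2 := @urn_expect_rising2 R q k.
have E2' : 2 * (2 * k%:R + 1 + q%:R) / (1 + q%:R) = 2 + 4 * k%:R / (1 + q%:R) :> R.
  by field; lra.
have E1 : urn_expect q k (fun x => x%:R * (x%:R + 1)) =
    urn_sqr q k + urn_expect q k (fun x => x%:R) :> R.
  by rewrite -urn_expectD; apply: eq_bigr => j _; congr (_ * _); ring.
split; last by rewrite -E2' -E2 E1 addrC addKr.
- have : urn_expect q k (fun x => 2^-1 * (x%:R * (x%:R + 1))) <= urn_sqr q k :> R.
    apply: le_urn_expect => x x0.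
    have x1 : 1 <= x%:R :> R by rewrite ler1n.
    nra.
  by rewrite urn_expectZ E2 E2'; lra.
- rewrite -E2' -E2; apply: le_urn_expect => x x0.
  by rewrite expr2 ler_wpM2l // lerDl.
Qed.

Lemma urn_norm_gt0 q k : 0 < urn_norm q k.
Proof.
rewrite sqrtr_gt0; have [h _ _] := urn_sqr_bounds q k; apply: lt_le_trans h.
by rewrite ltr_pwDl // divr_ge0 // ?mulr_ge0 // addr_ge0.
Qed.

Lemma urn_norm_sqr q k : urn_norm q k ^+ 2 = urn_sqr q k.
Proof. by rewrite sqr_sqrtr //; have := urn_norm_gt0 q k; rewrite sqrtr_gt0 => /ltW. Qed.

Lemma urn_norm_le q k : urn_norm q k <= 2 * Num.sqrt k.+1%:R.
Proof.
have k0 : 0 <= k%:R :> R by [].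
rewrite -[leLHS]ger0_norm ?sqrtr_ge0 // -ler_sqr ?nnegrE ?mulr_ge0 ?sqrtr_ge0 //.
rewrite ger0_norm ?sqrtr_ge0 // urn_norm_sqr exprMn sqr_sqrtr // -natr1.
have [_ h _] := urn_sqr_bounds q k; apply: le_trans h _.
have : k%:R / (1 + q%:R) <= k%:R :> R.
  by rewrite ler_pdivrMr ?ler_peMr // ?ltr_pwDl // lerDl.
by rewrite -mulrA; lra.
Qed.

Lemma urn_cdfE q k x : 0 <= x ->
  urn_cdf q k x = 1 - surv q k (Num.truncn (urn_norm q k * x)).
Proof.
move=> x0; rewrite -urn_expect_le; apply: eq_bigr => j _; congr (_ * _%:R).
rewrite ler_pdivrMr ?urn_norm_gt0 // mulrC truncn_ge_nat //.
by rewrite mulr_ge0 // ltW // urn_norm_gt0.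
Qed.

Lemma urn_cdf_lt0 q k x : x < 0 -> urn_cdf q k x = 0.
Proof.
move=> x0; apply: big1 => j _.
rewrite [_ <= _](_ : _ = false) ?mulr0 //; apply/negbTE; rewrite -ltNge.
by apply: lt_le_trans x0 _; rewrite divr_ge0 // ltW // urn_norm_gt0.
Qed.

Lemma igauss_lip n : exists2 C : R, 0 < C & forall x y : R, 0 <= x -> x <= y ->
  `|igauss n.+1 x - igauss n.+1 y| <= C * expR (- x) * (y - x).
Proof.
have [C C0 HC] := @igauss_bound R n; exists C => // x y x0 xy.
have [|c /andP[xc cy] E] :=
    @MVT_pointwise _ (igauss n.+1) (fun t => - igauss n t) x y xy.
  by move=> z /andP[xz _]; apply: is_derive_igauss; lra.
have c0 : 0 <= c by exact: le_trans xc.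
rewrite distrC E mulNr normrN ger0_norm ?mulr_ge0 ?subr_ge0 ?igauss_ge0 //.
rewrite ler_wpM2r ?subr_ge0 //; apply: le_trans (HC c c0) _.
by rewrite ler_pM2l // ler_expR lerN2.
Qed.

(** A bound uniform in [x], for replacing the exact normalisation by its limit: the exponential in
    [igauss_lip] tames the growing distance, as [y exp (- y) <= 1]. *)
Lemma igauss_dilate n : exists2 C : R, 0 < C & forall m a b x : R,
  0 < m -> m <= a -> m <= b -> 0 <= x ->
  `|igauss n.+1 (a * x) - igauss n.+1 (b * x)| <= C * (`|a - b| / m).
Proof.
have [C C0 HC] := igauss_lip n; exists C => // m a b x m0.
wlog ab : a b / a <= b.
  move=> h ma mb x0; have [ab|/ltW ba] := leP a b; first exact: h.
  by rewrite distrC [`|a - b|]distrC; exact: h.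
move=> ma mb x0; have a0 : 0 < a by lra.
apply: le_trans (HC _ _ _ _) _; rewrite ?mulr_ge0 ?(ltW a0) ?ler_wpM2r //.
rewrite -mulrA ler_pM2l // distrC ger0_norm ?subr_ge0 // -mulrBl mulrCA.
rewrite ler_wpM2l ?subr_ge0 //.
have e1 : a * x * expR (- (a * x)) <= 1.
  by rewrite expRN ler_pdivrMr ?expR_gt0 // mul1r; have := expR_ge1Dx (a * x); lra.
have xe : x * expR (- (a * x)) <= a^-1.
  by rewrite -[leRHS]mul1r ler_pdivlMr // mulrC mulrA.
by rewrite mulrC; apply: le_trans xe _; rewrite lef_pV2 ?posrE.
Qed.

Lemma urn_cdf_ge0 q k x : 0 <= urn_cdf q k x <= 1.
Proof.
apply/andP; split.
  by rewrite -[leLHS](urn_expect_cst q k 0); apply: le_urn_expect => d _.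
by rewrite -[leRHS](urn_expect_cst q k 1); apply: le_urn_expect => d _; rewrite lern1 leq_b1.
Qed.

Lemma K_bounds (q : nat) (s x : R) : 2 * s = q%:R + 1 -> 0 <= K s x <= 1.
Proof.
move=> sq; have [x0|x0] := leP 0 x; last by rewrite K_le0 ?lexx ?ler01 // ltW.
have s0 : 0 <= x / Num.sqrt (2 * s) by rewrite divr_ge0 ?sqrtr_ge0.
have I0 : 0 < igauss q.+1 0 :> R by exact: igauss_gt0.
rewrite (K_igauss sq) // subr_ge0 ler_pdivrMr // mul1r igauss_nincr //=.
by rewrite gerBl divr_ge0 ?igauss_ge0.
Qed.

(** By [urn_sqr_bounds] the squares of the two quantities differ by [(2 - E X_k) / scale k ^ 2]. The
    mean is of order [scale k], and dividing by their sum gives the rate. *)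
Lemma urn_norm_scale q k : (0 < k)%N ->
  let r := Num.sqrt (q%:R + 1) in
  [/\ (2 * r)^-1 <= urn_norm q k / scale k &
   `|urn_norm q k / scale k - r^-1| <= 4 * r / scale k].
Proof.
move=> k0 r; have k1 : 1 <= k%:R :> R by rewrite ler1n.
have q0 := ler0n R q.
have r1 : 0 < r by rewrite sqrtr_gt0; lra.
have r2 : r ^+ 2 = q%:R + 1 by rewrite sqr_sqrtr //; lra.
have s1 := @scale_ge1 R k k0; have s2 := @scale_sqr R k.
have sE : scale k = 2 * Num.sqrt k%:R :> R by [].
have [h1 h2 h3] := urn_sqr_bounds q k.
have b0 := urn_norm_gt0 q k; have b2 := urn_norm_sqr q k.
set beta := urn_norm q k / scale k.
have s0 : 0 < scale k :> R by lra.
have beta0 : 0 < beta by rewrite divr_gt0.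
have beta2 : beta ^+ 2 = urn_sqr q k / (4 * k%:R) by rewrite expr_div_n b2 s2.
have qk : 0 < 4 * k%:R :> R by lra.
have rV : (1 + q%:R)^-1 = r^-1 ^+ 2 by rewrite exprVn r2 addrC.
split.
  rewrite -[leRHS]ger0_norm ?(ltW beta0) //.
  rewrite -ler_sqr ?nnegrE ?invr_ge0 ?mulr_ge0 ?(ltW r1) //.
  rewrite ger0_norm ?(ltW beta0) // beta2 ler_pdivlMr //.
  apply: le_trans h1; rewrite invfM exprMn -rV.
  have : 0 <= k%:R / (1 + q%:R) :> R by rewrite divr_ge0 // addr_ge0.
  by move: (1 + q%:R)^-1 => v; lra.
(* By [x <= x ^ 2 / s + s / 4] with [s = scale k], and a second moment of at most [2 s ^ 2]. *)
have EX : urn_expect q k (fun x => x%:R) <= 5 / 2 * scale k :> R.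
  have : urn_expect q k (fun x => x%:R) <=
      urn_expect q k (fun x => (scale k)^-1 * x%:R ^+ 2 + scale k / 4) :> R.
    apply: le_urn_expect => x _; rewrite -subr_ge0.
    have -> : (scale k)^-1 * x%:R ^+ 2 + scale k / 4 - x%:R =
      (x%:R - scale k / 2) ^+ 2 / scale k :> R by field; rewrite gt_eqF.
    by rewrite divr_ge0 ?sqr_ge0 // ltW.
  rewrite urn_expectD (urn_expectZ q k (scale k)^-1 (fun x => x%:R ^+ 2)).
  rewrite urn_expect_cst -/(urn_sqr q k).
  have : (scale k)^-1 * urn_sqr q k <= 2 * scale k.
    rewrite ler_pdivrMl // mulrCA -expr2 s2; apply: le_trans h2 _.
    have : k%:R / (1 + q%:R) <= k%:R :> R.
      by rewrite ler_pdivrMr ?ler_peMr // ?ltr_pwDl // lerDl.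
    by rewrite -mulrA; lra.
  by lra.
have EX0 : 0 <= urn_expect q k (fun x => x%:R) :> R.
  by rewrite -(urn_expect_cst q k 0); apply: le_urn_expect.
have dE : beta ^+ 2 - r^-1 ^+ 2 =
    (2 - urn_expect q k (fun x => x%:R)) / (4 * k%:R).
  rewrite h3 beta2 -rV; field; lra.
have dle : `|beta ^+ 2 - r^-1 ^+ 2| <= 4 / scale k.
  rewrite dE normrM normfV (gtr0_norm qk) ler_pdivrMr // -s2.
  have -> : 4 / scale k * scale k ^+ 2 = 4 * scale k :> R by field; rewrite gt_eqF.
  by rewrite ler_norml; apply/andP; split; lra.
have rV0 : 0 < r^-1 by rewrite invr_gt0.
have fac : `|beta - r^-1| * (beta + r^-1) <= 4 / scale k.
  by rewrite -(gtr0_norm (addr_gt0 beta0 rV0)) -normrM -subr_sqr.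
have : `|beta - r^-1| * r^-1 <= 4 / scale k.
  by apply: le_trans fac; rewrite ler_wpM2l // lerDr ltW.
by rewrite ler_pdivrMr // => /le_trans; apply; rewrite mulrAC.
Qed.

(** Three errors of order [1 / scale k] add up: that of [surv_approx], the rounding of
    [urn_norm q k * x] to an integer, and the replacement of [urn_norm q k / scale k] by its
    limit. *)
Lemma urn_cdf_upper (q : nat) (s : R) : 2 * s = q%:R + 1 ->
  exists2 C : R, 0 < C & forall k x,
    `|urn_cdf q k x - K s x| <= C / Num.sqrt k.+1%:R.
Proof.
move=> sq; have [C1 C10 H1] := @surv_approx R q.
have [C2 C20 H2] := igauss_lip q; have [C3 C30 H3] := igauss_dilate q.
have I0 : 0 < igauss q.+1 0 :> R by exact: igauss_gt0.
pose r : R := Num.sqrt (q%:R + 1).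
have r0 : 0 < r by rewrite sqrtr_gt0 ltr_wpDl.
pose B := C1 + (C2 + C3 * (4 * r * (2 * r))) / igauss q.+1 0.
have B0 : 0 < B.
  by rewrite addr_gt0 // divr_gt0 // addr_gt0 // !mulr_gt0.
exists (1 + B); first by rewrite addr_gt0.
move=> k x; have /andP[F0 F1] := urn_cdf_ge0 q k x.
have /andP[K0 K1] := @K_bounds q s x sq.
have sk0 : 0 < Num.sqrt k.+1%:R :> R by rewrite sqrtr_gt0.
have [x0|x0] := leP 0 x; last first.
  by rewrite urn_cdf_lt0 // K_le0 ?subrr ?normr0 ?divr_ge0 // ltW // addr_gt0.
(* As [scale 0 = 0], the case [k = 0] is treated apart: both values lie in [[0, 1]], whence the 1 in
   the constant. *)
case: k F0 F1 sk0 => [|k] F0 F1 sk0.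
  by rewrite sqrtr1 divr1 ler_norml; apply/andP; split; lra.
have kS : (0 < k.+1)%N by [].
have s1 := @scale_ge1 R k.+1 kS.
have s0 : 0 < scale k.+1 :> R by lra.
apply: le_trans (_ : B / scale k.+1 <= _); last first.
  apply: ler_pM; rewrite ?invr_ge0 ?(ltW s0) ?(ltW B0) //; first by lra.
  rewrite lef_pV2 ?posrE // -ler_sqr ?nnegrE ?(ltW s0) ?(ltW sk0) //.
  have k0 : 0 <= k%:R :> R by [].
  by rewrite sqr_sqrtr // scale_sqr -!natr1; lra.
rewrite urn_cdfE // (K_igauss sq) // sq -/r.
set j := Num.truncn _.
have b0 := urn_norm_gt0 q k.+1.
have bx0 : 0 <= urn_norm q k.+1 * x by rewrite mulr_ge0 // ltW.
have j1 : j%:R <= urn_norm q k.+1 * x by rewrite /j -truncn_ge_nat.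
have j2 := truncnS_gt (urn_norm q k.+1 * x).
rewrite -/j in j2.
have {}H1 := H1 k.+1 j kS.
have [n1 n2] := urn_norm_scale q kS; rewrite -/r in n1 n2.
have js0 : 0 <= j%:R / scale k.+1 :> R by rewrite divr_ge0 // ltW.
have js : j%:R / scale k.+1 <= urn_norm q k.+1 / scale k.+1 * x.
  by rewrite mulrAC ler_pM2r ?invr_gt0.
have {}H2 := H2 _ _ js0 js.
have rr : (2 * r)^-1 <= r^-1 by rewrite lef_pV2 ?posrE ?mulr_gt0 //; lra.
have rr0 : 0 < (2 * r)^-1 by rewrite invr_gt0 mulr_gt0.
have {}H3 := H3 _ _ _ _ rr0 n1 rr x0.
have -> : x / r = r^-1 * x by rewrite mulrC.
have {}H2 : `|igauss q.+1 (j%:R / scale k.+1) -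
    igauss q.+1 (urn_norm q k.+1 / scale k.+1 * x)| <= C2 / scale k.+1.
  apply: le_trans H2 _; rewrite -mulrA ler_pM2l //.
  have e1 : expR (- (j%:R / scale k.+1)) <= 1 :> R.
    by rewrite -[leRHS]expR0 ler_expR oppr_le0.
  have d0 : urn_norm q k.+1 / scale k.+1 * x - j%:R / scale k.+1 <= (scale k.+1)^-1.
    rewrite mulrAC -mulrBl -[leRHS]mul1r ler_pM2r ?invr_gt0 //.
    by rewrite -natr1 in j2; lra.
  rewrite -[leRHS]mul1r; by apply: ler_pM => //; rewrite subr_ge0.
have {}H3 : `|igauss q.+1 (urn_norm q k.+1 / scale k.+1 * x) -
    igauss q.+1 (r^-1 * x)| <= C3 * (4 * r * (2 * r)) / scale k.+1.
  apply: le_trans H3 _; rewrite -mulrA ler_pM2l // invrK mulrAC ler_pM2r ?mulr_gt0 //.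
move: (surv _ _ _) (igauss q.+1 (j%:R / _)) (igauss q.+1 (_ / _ * x))
  (igauss q.+1 (r^-1 * x)) H1 H2 H3 => S i1 i2 i3 H1 H2 H3.
have -> : 1 - S - (1 - i3 / igauss q.+1 0) =
  - (S - i1 / igauss q.+1 0) - ((i1 - i2) + (i2 - i3)) / igauss q.+1 0 by ring.
apply: (le_trans (ler_normB _ _)).
have -> : B / scale k.+1 = C1 / scale k.+1 + (C2 / scale k.+1
  + C3 * (4 * r * (2 * r)) / scale k.+1) / igauss q.+1 0 by rewrite /B; ring.
rewrite normrN; apply: lerD => //.
rewrite normrM normfV (gtr0_norm I0) ler_pM2r ?invr_gt0 //.
by apply: (le_trans (ler_normD _ _)); exact: lerD.
Qed.

(** By Chebyshev's inequality the first [m > 2 * urn_norm q k] states carry mass at least [3 / 4].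
    As [m] is at most [5 * sqrt (k + 1)], one of them carries at least the average. *)
Lemma urn_atom q k : exists j, 3 / (20 * Num.sqrt k.+1%:R) <= urn_pmf q k j :> R.
Proof.
have b0 := urn_norm_gt0 q k; have b2 := urn_norm_sqr q k.
have ble := urn_norm_le q k.
have r1 : 1 <= Num.sqrt k.+1%:R :> R.
  by rewrite -[leLHS]sqrtr1; apply: ler_wsqrtr; rewrite ler1n.
set r := Num.sqrt _ in ble r1 *.
pose m := (Num.truncn (2 * urn_norm q k)).+1.
have tb0 : 0 <= 2 * urn_norm q k by lra.
have m1 : 2 * urn_norm q k < m%:R by exact: truncnS_gt.
have m2 : m%:R <= 5 * r.
  rewrite /m -natr1; have : (Num.truncn (2 * urn_norm q k))%:R <= 2 * urn_norm q k.
    by rewrite truncn_le.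
  by lra.
have m0 : 0 < m%:R :> R by rewrite ltr0n.
have tail : surv q k m <= 4^-1 :> R.
  have : urn_expect q k (fun=> 1) <=
      urn_expect q k (fun x => (x <= m)%:R + (m%:R ^+ 2)^-1 * x%:R ^+ 2) :> R.
    apply: le_urn_expect => x _; have [_|mx] := leqP x m.
      by rewrite lerDl mulr_ge0 ?invr_ge0 ?sqr_ge0.
    rewrite add0r ler_pdivlMl ?exprn_gt0 // mulr1.
    by rewrite ler_pXn2r ?nnegrE ?ler0n // ler_nat ltnW.
  rewrite urn_expect_cst urn_expectD urn_expect_le.
  rewrite (urn_expectZ q k _ (fun x => x%:R ^+ 2)) -/(urn_sqr q k) -b2.
  have : (m%:R ^+ 2)^-1 * urn_norm q k ^+ 2 <= 4^-1.
    by rewrite ler_pdivrMl ?exprn_gt0 //; nra.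
  by lra.
apply: contrapT => /forallNP H.
have : \sum_(0 <= j < m) urn_pmf q k j < \sum_(0 <= j < m) 3 / (20 * r) :> R.
  apply: ltr_sum_nat => // j _; rewrite ltNge; apply/negP; exact: H.
rewrite surv_urn_pmf // surv0 sumr_const_nat subn0 -mulr_natr.
have : 3 / (20 * r) * m%:R <= 3 / (20 * r) * (5 * r).
  by rewrite ler_wpM2l // divr_ge0 //; lra.
have -> : 3 / (20 * r) * (5 * r) = 3 / 4 by field; lra.
by lra.
Qed.

Lemma K_lip (q : nat) (s : R) : 2 * s = q%:R + 1 ->
  exists2 L : R, 0 < L & forall x y, 0 <= y -> y <= x ->
    K s x - K s y <= L * (x - y).
Proof.
move=> sq; have [C C0 HC] := igauss_lip q.
have I0 : 0 < igauss q.+1 0 :> R by exact: igauss_gt0.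
have r0 : 0 < Num.sqrt (2 * s) by rewrite sqrtr_gt0 sq ltr_wpDl.
exists (C / Num.sqrt (2 * s) / igauss q.+1 0); first by rewrite !divr_gt0.
move=> x y y0 yx; rewrite !(K_igauss sq) //; last exact: le_trans yx.
have yr0 : 0 <= y / Num.sqrt (2 * s) by rewrite divr_ge0 // ltW.
have yxr : y / Num.sqrt (2 * s) <= x / Num.sqrt (2 * s).
  by rewrite ler_pM2r ?invr_gt0.
have := HC _ _ yr0 yxr; move/(le_trans (ler_norm _)) => h.
have e1 : expR (- (y / Num.sqrt (2 * s))) <= 1.
  by rewrite -[leRHS]expR0 ler_expR oppr_le0.
have -> : 1 - igauss q.+1 (x / Num.sqrt (2 * s)) / igauss q.+1 0 -
    (1 - igauss q.+1 (y / Num.sqrt (2 * s)) / igauss q.+1 0) =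
  (igauss q.+1 (y / Num.sqrt (2 * s)) - igauss q.+1 (x / Num.sqrt (2 * s)))
    / igauss q.+1 0 by ring.
rewrite mulrAC ler_pM2r ?invr_gt0 //; apply: (le_trans h).
rewrite -mulrBl; move: (expR _) e1 => e e1.
have -> : C * e * ((x - y) / Num.sqrt (2 * s))
  = C / Num.sqrt (2 * s) * (x - y) * e by ring.
by rewrite ler_piMr // mulr_ge0 ?subr_ge0 // divr_ge0 // ltW.
Qed.

(** Across an atom of mass [p] the urn jumps by [p] while [K s] moves by at most [p / 2]; two points
    at distance [D] then give [p <= 2 D + p / 2]. *)
Lemma urn_cdf_lower (q k : nat) (s D : R) : 2 * s = q%:R + 1 ->
  (forall x, `|urn_cdf q k x - K s x| <= D) -> 3 / 80 / Num.sqrt k.+1%:R <= D.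
Proof.
move=> sq HD; have [L L0 HL] := K_lip sq.
have b0 := urn_norm_gt0 q k.
have r0 : 0 < Num.sqrt k.+1%:R :> R by rewrite sqrtr_gt0.
have [j] := urn_atom q k.
have p0 : 0 < 3 / (20 * Num.sqrt k.+1%:R) :> R by rewrite divr_gt0 ?mulr_gt0.
set p := urn_pmf q k j => pj; have {}p0 : 0 < p by exact: lt_le_trans pj.
pose x := j.+1%:R / urn_norm q k.
(* The first bound keeps [x - e] from falling below the previous atom, the second keeps the
   variation of [K s] below [p / 2]. *)
pose e := Num.min (urn_norm q k)^-1 (p / (2 * L)).
have e0 : 0 < e by rewrite lt_min invr_gt0 b0 divr_gt0 ?mulr_gt0.
have e1 : e <= (urn_norm q k)^-1 by rewrite ge_min lexx.
have e2 : L * e <= p / 2.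
  have : e <= p / (2 * L) by rewrite ge_min lexx orbT.
  by rewrite ler_pdivlMr ?mulr_gt0 //; lra.
have xb : urn_norm q k * x = j.+1%:R by rewrite mulrC divfK // gt_eqF.
have yb : urn_norm q k * (x - e) = j.+1%:R - urn_norm q k * e by rewrite mulrBr xb.
have be0 : 0 < urn_norm q k * e by rewrite mulr_gt0.
have be1 : urn_norm q k * e <= 1.
  by rewrite -ler_pdivlMl // mulr1.
have x0 : 0 <= x by rewrite divr_ge0 // ltW.
have y0 : 0 <= x - e.
  rewrite -(pmulr_rge0 _ b0) yb -natr1; have : 0 <= j%:R :> R by [].
  by lra.
have Fx := @urn_cdfE q k x x0; have Fy := @urn_cdfE q k (x - e) y0.
rewrite xb natrK in Fx.
rewrite yb (@truncn_def _ _ j) in Fy; last first.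
  by rewrite -natr1; apply/andP; split; lra.
have hx := HD x; have hy := HD (x - e).
have xe : x - e <= x by lra.
have hK := HL x (x - e) y0 xe.
have pE : p = urn_cdf q k x - urn_cdf q k (x - e) by rewrite Fx Fy /p /urn_pmf; ring.
have -> : 3 / 80 / Num.sqrt k.+1%:R = 3 / (20 * Num.sqrt k.+1%:R) / 4 :> R.
  by field; rewrite gt_eqF.
move: hx hy; rewrite !ler_norml => /andP[_ hx] /andP[hy _].
have xeE : x - (x - e) = e by ring.
by rewrite xeE in hK; lra.
Qed.

End urn_limit.

(** * Conclusion *)

Section degree_law.
Context {R : realType} d (T : measurableType d) (P : probability T R).
Variables (G : nat -> {RV P >-> digraph}) (n i q k : nat).
Hypothesis degree_law : forall f : nat -> R, (forall x, 0 <= f x) ->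
  (\int[P]_w (f (degree i (G n w)))%:E = (urn_expect q k f)%:E)%E.

Lemma b_urn_norm : b P G n i = urn_norm q k.
Proof.
rewrite /b unlock /urn_norm /urn_sqr.
by rewrite (@degree_law (fun x => x%:R ^+ 2)) // => x; exact: sqr_ge0.
Qed.

Lemma law_cdf_urn x : law_cdf P (scaledW P G n i) x = urn_cdf q k x.
Proof.
pose X : {RV P >-> R} := scaledW P G n i.
have mA : measurable (X @^-1` `]-oo, x]).
  by rewrite -[X in measurable X]setTI; apply: measurable_funP.
rewrite /law_cdf /cdf /distribution /pushforward /= -[LHS]/(fine (P (X @^-1` `]-oo, x]))).
rewrite -[X in P X]setIT -(@integral_indic _ _ _ P) //.
rewrite /urn_cdf -[RHS]/(fine (urn_expect q k _)%:E) -degree_law //.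
congr fine; apply: eq_integral => w _; congr (_%:E).
rewrite indicE -b_urn_norm; congr (nat_of_bool _)%:R.
by apply/idP/idP; rewrite inE /= in_itv.
Qed.

Lemma dK_bounds (s : R) : 2 * s = q%:R + 1 ->
  forall C, (forall x, `|urn_cdf q k x - K s x| <= C) ->
  3 / 80 / Num.sqrt k.+1%:R <= dK (law_cdf P (scaledW P G n i)) (K s) <= C.
Proof.
move=> sq C HC; have -> : law_cdf P (scaledW P G n i) = urn_cdf q k.
  by apply/funext => x; exact: law_cdf_urn.
(* The real [sup] dominates its set only when the set is bounded, so the uniform bound [C] also
   enters the lower estimate. *)
have ub : has_ubound (range (fun x => `|urn_cdf q k x - K s x|)).
  by exists C => _ [x _ <-].
apply/andP; split; last first.
  apply: ge_sup; first by exists (`|urn_cdf q k 0 - K s 0|), 0.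
  by move=> _ [x _ <-].
by apply: (urn_cdf_lower sq) => x; apply: ub_le_sup.
Qed.

End degree_law.

(** Here [k] is [n - i] in Model 1 and [n - i + 1] in Model 2. The two inequalities make [n] and
    [k + 1] comparable, at the cost of the factors [sqrt i] and 2 in the constants. *)
Lemma degree_rate (R : realType) (q i : nat) (s : R) : (0 < i)%N ->
  2 * s = q%:R + 1 -> exists c C : R, [/\ 0 < c, 0 < C &
    forall d (T : measurableType d) (P : probability T R)
      (G : nat -> {RV P >-> digraph}) (n k : nat),
    (n <= i * k.+1)%N -> (k < 2 * n)%N ->
    (forall f : nat -> R, (forall x, 0 <= f x) ->
      (\int[P]_w (f (degree i (G n w)))%:E = (urn_expect q k f)%:E)%E) ->
    c / Num.sqrt n%:R <= dK (law_cdf P (scaledW P G n i)) (K s) <= C / Num.sqrt n%:R].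
Proof.
move=> i0 sq; have [C C0 HC] := urn_cdf_upper sq.
have i1 : 0 < i%:R :> R by rewrite ltr0n.
have ri0 : 0 < Num.sqrt i%:R :> R by rewrite sqrtr_gt0.
exists (3 / 80 / 2), (C * Num.sqrt i%:R); split.
- by rewrite !divr_gt0.
- by rewrite mulr_gt0.
move=> d T P G n k ni kn law.
have n0 : (0 < n)%N by lia.
have rn0 : 0 < Num.sqrt n%:R :> R by rewrite sqrtr_gt0 ltr0n.
have rk0 : 0 < Num.sqrt k.+1%:R :> R by rewrite sqrtr_gt0.
have /andP[lo up] := dK_bounds law sq (HC k).
apply/andP; split.
  apply: le_trans lo; rewrite -[leLHS]mulrA ler_pM2l // -invfM lef_pV2 ?posrE ?mulr_gt0 //.
  have -> : 2 = Num.sqrt 4 :> R.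
    by rewrite (_ : 4 = 2 ^+ 2) ?sqrtr_sqr ?ger0_norm // -natrX.
  by rewrite -sqrtrM // ler_wsqrtr // -natrM ler_nat; lia.
apply: le_trans up _; rewrite -mulrA ler_pM2l // ler_pdivlMr // mulrC ler_pdivrMr //.
by rewrite -sqrtrM // ler_wsqrtr // -natrM ler_nat.
Qed.

Theorem theorem1p1 (R : realType) (d : measure_display) (T : measurableType d)
    (P : probability T R) (G : nat -> {RV P >-> digraph}) :
  (model1 P G -> forall i : nat, (2 <= i)%N ->
    exists c C : R, [/\ 0 < c, 0 < C & forall n : nat, (i <= n)%N ->
      c / Num.sqrt n%:R <= dK (law_cdf P (scaledW P G n i)) (K (i%:R - 1))
        <= C / Num.sqrt n%:R]) /\
  (model2 P G -> forall i : nat, (1 <= i)%N ->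
    exists c C : R, [/\ 0 < c, 0 < C & forall n : nat, (i <= n)%N ->
      c / Num.sqrt n%:R <= dK (law_cdf P (scaledW P G n i)) (K (i%:R - 2^-1))
        <= C / Num.sqrt n%:R]).
Proof.
split=> PG i i0.
  have sq : 2 * (i%:R - 1) = (2 * i - 3)%N%:R + 1 :> R.
    by rewrite natrB ?natrM; [ring|lia].
  have [|c [C [c0 C0 H]]] := @degree_rate R _ i _ _ sq; first by lia.
  exists c, C; split=> // n ni; apply: (H _ _ _ _ _ (n - i)%N); [nia|lia|].
  by move=> f f0; apply: model1_integral => //; rewrite i0.
have sq : 2 * (i%:R - 2^-1) = (2 * i - 2)%N%:R + 1 :> R.
  by rewrite natrB ?natrM; [field|lia].
have [c [C [c0 C0 H]]] := @degree_rate R _ i _ i0 sq.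
exists c, C; split=> // n ni; apply: (H _ _ _ _ _ (n - i).+1); [nia|lia|].
by move=> f f0; apply: model2_integral => //; rewrite i0.
Qed.
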